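(* Let $n \in \mathbb{N}$ and $k_0, k_1 \in \mathbb{R}$. There exists $N = N(n,k_0,k_1) > 0$ (depending only on $n,k_0,k_1$) such that the following holds. Let $0<T < \infty$ and let $u:\mathbb{R}^n \times [0,T] \to \mathbb{R}$ be a smooth solution of the biharmonic heat flow $\frac{\partial}{\partial t} u = -\Delta^2 u$ on $\mathbb{R}^n\times[0,T]$ that satisfies $$|\Delta u|^2(x,t) \leq \frac{k_0}{t} \quad \text{for all } t \in [0,T],\ x \in \mathbb{R}^n,$$ and $$\sup_{B_1(0)} \sum_{i=0}^{2n+2} |\nabla^i u_0|^2 \leq k_1 < \infty,$$ where $u_0(\cdot) := u(\cdot,0)$. Then $$|\Delta u|^2(x,t) \leq \frac{N}{(1-|x|)^4}$$ for all $x,t$ which satisfy $x \in \overline{B_1(0)}$, $(1-|x|)^4 \geq Nt$, $t \leq \frac{1}{N}$ and $t \leq T$ (with $t \ge 0$).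
   Context: $B_r(x)$ is the ball of radius $r$ about $x$ in $\mathbb{R}^n$. $\Delta$ is the spatial Laplacian, and $\Delta^k$ is its $k$-th iterate. $\nabla^i u(x,t)$ is the full $i$-th spatial derivative (the tensor of all $i$-th order partial derivatives, with $\nabla^0 u = u$), and $|\nabla^i u|$ is its standard norm, e.g. $|\nabla^2 u|^2 = \sum_{i,j=1}^n |\nabla_i\nabla_j u|^2$. ''Smooth'' on $\mathbb{R}^n\times[0,T]$ means smooth in space and time up to and including $t=0$. Convention: $M/0 = \infty$ for $M>0$; the bound $|\Delta u|^2 \le k_0/t$ is understood as $t|\Delta u|^2(x,t) \le k_0$. *)

(* Defs.v *)
From mathcomp Require Import all_boot all_order all_algebra.
From mathcomp Require Import all_classical all_reals all_analysis.

Set Implicit Arguments.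
Unset Strict Implicit.
Unset Printing Implicit Defensive.

Import Order.TTheory GRing.Theory Num.Theory.
Import numFieldNormedType.Exports.

Local Open Scope classical_set_scope.
Local Open Scope ring_scope.

(* The library norm on 'rV[R]_n is the sup norm, hence an explicit Euclidean
   norm for |x|; both induce the same topology. *)
Definition enorm (R : realType) (n : nat) (x : 'rV[R]_n) : R :=
  Num.sqrt (\sum_(i < n) x 0 i ^+ 2).

Definition eball (R : realType) (n : nat) (x : 'rV[R]_n) (r : R) :
    set 'rV[R]_n :=
  [set y | enorm (y - x) < r].

Definition partial (R : realType) (n : nat) (i : 'I_n) (f : 'rV[R]_n -> R) :
    'rV[R]_n -> R :=
  fun x => 'D_(delta_mx 0 i) f x.

Definition laplacian (R : realType) (n : nat) (f : 'rV[R]_n -> R) :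
    'rV[R]_n -> R :=
  fun x => \sum_(i < n) partial i (partial i f) x.

(* |nabla^k f|^2 (x): sum over all k-tuples of directions, so a mixed partial
   derivative is counted once for each ordering. *)
Definition sqnorm_nabla (R : realType) (n k : nat) (f : 'rV[R]_n -> R)
    (x : 'rV[R]_n) : R :=
  \sum_(J : k.-tuple 'I_n) (foldr (@partial R n) f J x) ^+ 2.

(* Time derivatives are taken within [0, T], so that they are one-sided at
   t = 0 and t = T and ignore the values of u at times outside [0, T]. *)
Definition time_quotient (R : realType) (n : nat) (u : 'rV[R]_n -> R -> R)
    (x : 'rV[R]_n) (t s : R) : R :=
  (u x s - u x t) / (s - t).

Definition time_derivable (R : realType) (n : nat) (T : R)
    (u : 'rV[R]_n -> R -> R) (x : 'rV[R]_n) (t : R) : Prop :=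
  cvg (time_quotient u x t @ within `[0, T] t^').

Definition time_deriv (R : realType) (n : nat) (T : R)
    (u : 'rV[R]_n -> R -> R) : 'rV[R]_n -> R -> R :=
  fun x t => lim (time_quotient u x t @ within `[0, T] t^').

(* A space-time direction is Some i for the i-th space variable, None for
   time. *)
Definition st_derivable (R : realType) (n : nat) (T : R) (d : option 'I_n)
    (u : 'rV[R]_n -> R -> R) (x : 'rV[R]_n) (t : R) : Prop :=
  match d with
  | Some i => derivable (u^~ t) x (delta_mx 0 i)
  | None => time_derivable T u x t
  end.

Definition st_partial (R : realType) (n : nat) (T : R) (d : option 'I_n)
    (u : 'rV[R]_n -> R -> R) : 'rV[R]_n -> R -> R :=
  match d with
  | Some i => fun x t => partial i (u^~ t) x
  | None => time_deriv T u
  end.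

(* Smoothness on R^n x [0, T]: all iterated partial derivatives in space and
   time, in any order, exist and are jointly continuous on R^n x [0, T]. *)
Definition smooth_slab (R : realType) (n : nat) (T : R)
    (u : 'rV[R]_n -> R -> R) : Prop :=
  forall w : seq (option 'I_n),
    let v := foldr (st_partial T) u w in
    {within [set p : 'rV[R]_n * R | 0 <= p.2 <= T],
      continuous (fun p : 'rV[R]_n * R => v p.1 p.2)} /\
    forall (d : option 'I_n) (x : 'rV[R]_n) (t : R),
      0 <= t <= T -> st_derivable T d v x t.

Definition biharmonic_heat_flow (R : realType) (n : nat) (T : R)
    (u : 'rV[R]_n -> R -> R) : Prop :=
  forall (x : 'rV[R]_n) (t : R), 0 <= t <= T ->
    time_deriv T u x t = - laplacian (laplacian (u^~ t)) x.

(* Main.v *)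
Require Import Defs.
From mathcomp Require Import all_boot all_order all_algebra.
From mathcomp Require Import all_classical all_reals all_analysis.
From mathcomp Require Import ring lra.

Import Order.TTheory GRing.Theory Num.Theory.
Import numFieldNormedType.Exports.

Local Open Scope classical_set_scope.
Local Open Scope ring_scope.

Set Implicit Arguments.
Unset Strict Implicit.
Unset Printing Implicit Defensive.

(** The function [v = Delta u] solves the same equation, and [|v| <= sqrt (k0 / t)]
    is integrable in time, although its square is not.  Hence [V], the integral
    of [v] over [[0, t]], is bounded; it satisfies [V_t + Delta^2 V = v(., 0)]
    and [V(., 0) = 0].  Local energy estimates with the polynomial weights
    [prod_i (1 - x_i^2)^k] on a cube bound [Delta V] and then [Delta^2 V] in
    [L^2], and therefore [v = v(., 0) - Delta^2 V].  Starting from this [L^2]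
    bound, the energy estimates for the derivatives of [v] gain one derivative
    at a time; [n] derivatives give a pointwise bound of [v] at the centre of
    the cube.  This is applied on the cube of half-side [r = (1 - |x|) / (n + 1)]
    about [x], contained in the unit ball, after the scaling [t = r^4 s]. *)

(** * Calculus on a box *)

(** The obstacle is the time 0: an energy estimate for v itself requires the integral of v^2, for
    which the hypothesis offers only the divergent integral of k0 / t. For V the right-hand side is
    initial data, controlled by k1, and each round of the energy estimate gains one Laplacian. Two
    rounds reach Delta^2 V, and the equation turns this into a bound of v without ever squaring the
    singular bound.

    The weight plays the part of a cutoff. A derivative of psi^k costs one power of psi, and the
    powers that remain can be shared between the two factors of a product; hence lower-order terms
    are absorbed with matching weights (2 more powers for a gradient, 4 for a Laplacian), and the
    faces of the cube contribute nothing.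

    The quantity t |Delta u|^2 is invariant under parabolic scaling, so it suffices to work on a
    cube of half-side 1 for a time at most 1. Scaling back multiplies the bound of |Delta u|^2 by
    r^-4, whence the power 4 of 1 - |x| and the factor (n + 1)^4 in N. *)

Section Clip.
Context {R : realType}.
Implicit Types a b s t : R.

Definition clip a b s : R := Num.max a (Num.min s b).

Lemma clip_itv a b s : a <= b -> a <= clip a b s <= b.
Proof.
move=> ab; rewrite /clip le_max lexx /=.
by rewrite ge_max ab ge_min lexx orbT.
Qed.

Lemma clip_id a b s : a <= s <= b -> clip a b s = s.
Proof. by case/andP=> h1 h2; rewrite /clip min_l // max_r. Qed.

Lemma clip_clip a b s : a <= b -> clip a b (clip a b s) = clip a b s.
Proof. by move=> ab; rewrite clip_id// clip_itv. Qed.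

Lemma clip_lip a b s t : `|clip a b s - clip a b t| <= `|s - t|.
Proof.
rewrite /clip /Num.max /Num.min ler_norml.
have := ler_norm (s - t); have := lerNnormlW (lexx `|s - t|).
move: `|s - t| => u h1 h2.
by case: (ltrP s b) => ?; case: (ltrP t b) => ?; case: ltrP => ?;
  case: ltrP => ?; apply/andP; split; lra.
Qed.

Lemma clip_continuous a b : continuous (clip a b).
Proof.
move=> x; apply/cvgrPdist_lt => e e0; near=> y.
apply: le_lt_trans (clip_lip _ _ _ _) _; near: y.
exact: cvgr_dist_lt.
Unshelve. all: by end_near. Qed.

End Clip.

Section Prim1.
Context {R : realType}.
Notation mu := (@lebesgue_measure R).

(** Clipping the endpoint makes the primitive constant outside [a, b], so that primitives stay in
    the class of functions invariant under projection to the box. *)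
Definition prim1 (a b : R) (h : R -> R) (c : R) : R :=
  (\int[mu]_(t in `[a, clip a b c]) h t)%R.

Lemma prim1_a (a b : R) (h : R -> R) : a <= b -> prim1 a b h a = 0.
Proof.
by move=> ab; rewrite /prim1 clip_id ?lexx// set_itv1 Rintegral_set1.
Qed.

Lemma prim1_der (a b : R) (h : R -> R) (s : R) : continuous h -> a < s < b ->
  is_derive s 1 (prim1 a b h) (h s).
Proof.
move=> ch /andP[as_ sb].
have ih : mu.-integrable `[a, b] (EFin \o h).
  apply: continuous_compact_integrable; first exact: segment_compact.
  exact: continuous_subspaceT.
have [dF F'] := @continuous_FTC1_closed R h a s b sb ih as_ (ch s).
have E : {near s, (fun x => (\int[mu]_(t in `[a, x]) h t)%R) =1 prim1 a b h}.
  near=> c; rewrite /prim1 clip_id//; apply/andP; split; apply: ltW; near: c.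
    exact: lt_nbhsr.
  exact: lt_nbhsl.
apply: (@near_eq_is_derive _ _ _ (fun x => (\int[mu]_(t in `[a, x]) h t)%R)).
- exact: E.
- by apply: DeriveDef; [exact: dF|rewrite -derive1E; exact: F'].
Unshelve. all: by end_near. Qed.

Lemma prim1_cont (a b : R) (h : R -> R) : a <= b -> continuous h -> {within `[a, b], continuous (prim1 a b h)}.
Proof.
move=> ab ch.
have ih : mu.-integrable `[a, b] (EFin \o h).
  apply: continuous_compact_integrable; first exact: segment_compact.
  exact: continuous_subspaceT.
have := parameterized_integral_continuous ab ih.
apply: subspace_eq_continuous => x; rewrite inE/= in_itv/= => xab.
by rewrite /parameterized_integral/prim1/from_subspace clip_id.
Qed.

End Prim1.

(** * One-variable consequences of the mean value theorem *)

Section OneVar.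
Context {R : realType}.
Implicit Types (F dF : R -> R) (a b s l : R).

Lemma deriv_ge0_le F dF a b : a <= b ->
  (forall s, a < s < b -> is_derive s 1 F (dF s)) ->
  {within `[a, b], continuous F} ->
  (forall s, a < s < b -> 0 <= dF s) -> F a <= F b.
Proof.
rewrite le_eqVlt => /predU1P[-> //|ab] dFs cF h.
have dF' x : x \in `]a, b[ -> is_derive x 1 F (dF x) by rewrite in_itv/= => /dFs.
have [c] := MVT ab dF' cF.
rewrite in_itv/= => /h h1 h2; rewrite -subr_ge0 h2 mulr_ge0// subr_ge0 ltW//.
Qed.

Lemma deriv_bound F dF a b M : a <= b ->
  (forall s, a < s < b -> is_derive s 1 F (dF s)) ->
  {within `[a, b], continuous F} ->
  (forall s, a < s < b -> `|dF s| <= M) -> `|F b - F a| <= M * (b - a).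
Proof.
rewrite le_eqVlt => /predU1P[->|ab] dFs cF h.
  by rewrite !subrr normr0 mulr0.
have dF' x : x \in `]a, b[ -> is_derive x 1 F (dF x) by rewrite in_itv/= => /dFs.
have [c] := MVT ab dF' cF.
have ab0 : 0 <= b - a by rewrite subr_ge0 ltW.
rewrite in_itv/= => /h h1 h2; rewrite h2 normrM (ger0_norm ab0).
exact: ler_wpM2r.
Qed.

(** The first-order expansion, free of division: h = 0 needs no separate treatment in an estimate
    uniform in h. *)
Lemma is_derive_eps F s l :
  (forall e, 0 < e -> exists2 k, 0 < k &
    forall h, `|h| < k -> `|F (s + h) - F s - h * l| <= e * `|h|) ->
  is_derive s 1 F l.
Proof.
move=> H.
have C : h^-1 *: (F (h *: (1:R) + s) - F s) @[h --> (0:R)^'] --> l.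
  apply/cvgrPdist_le => e e0; have [k k0 Hk] := H e e0.
  near=> h.
  have h0 : h != 0 by near: h; exact: nbhs_dnbhs_neq.
  have hk : `|h| < k.
    near: h; apply: dnbhs0_lt; exact: k0.
  have := Hk h hk; rewrite -ler_pdivrMr ?normr_gt0//.
  apply: le_trans; rewrite -normfV -normrM distrC.
  rewrite /GRing.scale /= mulr1 (addrC h).
  suff -> : h^-1 * (F (s + h) - F s) - l = (F (s + h) - F s - h * l) / h by [].
  by field.
split; first by apply/cvg_ex; exists l.
exact/cvg_lim.
Unshelve. all: by end_near. Qed.

(** Composing with a map into A turns continuity on A into global continuity; this carries
    continuity on the slab over to functions extended by projection. *)
Lemma continuous_within_comp (T U : topologicalType) (A : set T) (f : T -> R)
    (g : U -> T) : {within A, continuous f} -> continuous g ->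
  (forall y, A (g y)) -> continuous (f \o g).
Proof.
move=> /subspace_continuousP cf cg Ag y.
apply: (@cvg_comp _ _ _ g f (nbhs y) (within A (nbhs (g y)))); last exact: cf.
move=> V; rewrite /within /= => hV.
have := cg y _ hV; rewrite /nbhs /=; apply: filterS => x; apply; exact: Ag.
Qed.

End OneVar.

(** * Functions on a box, their partial derivatives and iterated integrals *)

Section Box.
Context {R : realType} {m : nat} (lo hi : 'I_m -> R).
Hypothesis lohi : forall d, lo d < hi d.
Notation pt := 'rV[R]_m.
Implicit Types (z : pt) (d j : 'I_m) (f g : pt -> R).

Definition upd z d s : pt := \row_j (if j == d then s else z 0 j).
Definition clamp z : pt := \row_j clip (lo j) (hi j) (z 0 j).

Lemma updE z d s j : upd z d s 0 j = if j == d then s else z 0 j.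
Proof. by rewrite mxE. Qed.

Lemma upd_same z d s : upd z d s 0 d = s.
Proof. by rewrite updE eqxx. Qed.

Lemma upd_upd z d s t : upd (upd z d s) d t = upd z d t.
Proof. by apply/rowP => j; rewrite !mxE; case: eqP. Qed.

Lemma upd_id z d : upd z d (z 0 d) = z.
Proof. by apply/rowP => j; rewrite !mxE; case: eqP => // ->. Qed.

Lemma updC z d j s t : d != j -> upd (upd z d s) j t = upd (upd z j t) d s.
Proof.
move=> dj; apply/rowP => k; rewrite !mxE.
by case: (eqVneq k j) => // ->; rewrite eq_sym (negbTE dj).
Qed.

Lemma clamp_upd z d s : clamp (upd z d s) = upd (clamp z) d (clip (lo d) (hi d) s).
Proof. by apply/rowP => j; rewrite !mxE; case: eqP => // ->. Qed.

Lemma clampE z j : clamp z 0 j = clip (lo j) (hi j) (z 0 j).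
Proof. by rewrite mxE. Qed.

Lemma clamp_clamp z : clamp (clamp z) = clamp z.
Proof. by apply/rowP => j; rewrite !clampE clip_clip// ltW. Qed.

Lemma clamp_itv z j : lo j <= clamp z 0 j <= hi j.
Proof. by rewrite clampE clip_itv// ltW. Qed.

Definition close (e : R) z z' := forall j, `|z 0 j - z' 0 j| < e.

Lemma close_upd e z z' d s : 0 < e -> close e z z' -> close e (upd z d s) (upd z' d s).
Proof. by move=> e0 h j; rewrite !updE; case: eqP => // _; rewrite subrr normr0. Qed.

Lemma close_clamp e z z' : close e z z' -> close e (clamp z) (clamp z').
Proof. by move=> h j; rewrite !clampE; exact: le_lt_trans (clip_lip _ _ _ _) (h j). Qed.

Lemma ball_close e z z' : 0 < e -> ball z e z' <-> close e z z'.
Proof.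
move=> e0; split; last by move=> h; split => // i j; rewrite !ord1; exact: h.
by case=> _ h j; exact: h.
Qed.

(* Functions on the box are extended by the projection [clamp]: continuity is
   then a global notion, and no side condition on the base point is needed. *)
Definition boxcont f := continuous f /\ forall z, f (clamp z) = f z.

Definition ucont f := forall e : R, 0 < e -> exists2 k : R, 0 < k &
  forall z z', close k z z' -> `|f z - f z'| < e.

Lemma ucont_continuous f : ucont f -> continuous f.
Proof.
move=> h z; apply/(@cvgrPdist_lt _ _ _ _ (nbhs_filter z)) => e e0; have [k k0 H] := h e e0.
apply/nbhs_ballP; exists k => //= z' bz; apply: H; exact/(ball_close _ _ k0).
Qed.

(** Heine-Cantor: the box is compact, and the projection brings any two points into it without
    increasing their coordinatewise distance. *)
Lemma boxcont_ucont f : boxcont f -> ucont f.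
Proof.
move=> [cf fc] e e0.
pose K := [set v : pt | forall i, [set` `[lo i, hi i]] (v ord0 i)].
have cK : compact K.
  by apply: (@rV_compact _ m (fun i => [set` `[lo i, hi i]])) => i; exact: segment_compact.
pose P (k : R) (z : pt) := forall z', close k z z' -> `|f z - f z'| < e.
have H : \forall k \near (0:R)^'+, K `<=` P k.
  apply: (proj1 (@compact_near_coveringP _ K) cK) => //.
  move=> x _.
  have e20 : 0 < e / 2 by rewrite divr_gt0.
  have /cvgrPdist_lt/(_ _ e20)/nbhs_ballP[r /= r0 H] := cf x.
  have r20 : 0 < r / 2 by rewrite divr_gt0.
  exists (ball x (r / 2), [set k : R | k < r / 2]) => /=.
    split; first exact: nbhsx_ballx.
    near=> k; near: k; exact: nbhs_right_lt.
  move=> [x' k] /= [/(ball_close _ _ r20) bx' kr] z' cz'; rewrite /= in kr.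
  have h1 : `|f x - f x'| < e / 2.
    apply: H; apply/ball_close => // j; apply: lt_trans (bx' j) _; lra.
  have h2 : `|f x - f z'| < e / 2.
    apply: H; apply/ball_close => // j.
    have := ler_normD (x 0 j - x' 0 j) (x' 0 j - z' 0 j).
    rewrite addrA subrK; move=> h; apply: le_lt_trans h _.
    by rewrite (splitr r) ltrD// (lt_trans (cz' j)).
  have := ler_normD (f x' - f x) (f x - f z').
  rewrite addrA subrK (distrC (f x') (f x)) => h; apply: le_lt_trans h _.
by rewrite (splitr e) ltrD.
have [k [k0 Hk]] : exists k : R, 0 < k /\ K `<=` P k.
  near (0 : R)^'+ => k; exists k; split; first by near: k; exact: nbhs_right_gt.
  by near: k.
exists k => // z z' czz'.
rewrite -(fc z) -(fc z'); apply: Hk; last exact: close_clamp.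
by move=> i /=; rewrite in_itv /= clamp_itv.
Unshelve. all: by end_near. Qed.

Lemma line_continuous f z d : ucont f -> continuous (fun s => f (upd z d s)).
Proof.
move=> uf s; apply/cvgrPdist_lt => e e0; have [k k0 H] := uf e e0.
near=> t; apply: H => j; rewrite !updE; case: eqP => _; last by rewrite subrr normr0.
by near: t; exact: cvgr_dist_lt.
Unshelve. all: by end_near. Qed.

(* [g] is the derivative of [f] in direction [d] inside the box; at the faces
   [lo d] and [hi d] one relies on continuity alone. *)
Definition pd d f g := forall z s, lo d < s < hi d ->
  is_derive s 1 (fun s => f (upd z d s)) (g (upd z d s)).

Lemma boxcont_upd f z d s : boxcont f ->
  f (upd z d s) = f (upd z d (clip (lo d) (hi d) s)).
Proof.
move=> [_ fc]; rewrite -fc -[RHS]fc !clamp_upd clip_clip//; exact/ltW.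
Qed.

Lemma clip_mono (a b s t : R) : s <= t -> clip a b s <= clip a b t.
Proof.
move=> st; rewrite /clip; case: (lerP s b); case: (lerP t b) => ? ?;
  rewrite ?ge_max ?le_max ?lexx ?orbT ?st//=; lra.
Qed.

Lemma pd_mono d f g z s t : boxcont f -> pd d f g ->
  (forall r, lo d < r < hi d -> 0 <= g (upd z d r)) ->
  s <= t -> f (upd z d s) <= f (upd z d t).
Proof.
move=> bf pfg g0 st; rewrite (boxcont_upd _ _ s)// (boxcont_upd _ _ t)//.
have lh := ltW (lohi d).
have /andP[s1 s2] := clip_itv s lh; have /andP[t1 t2] := clip_itv t lh.
apply: (@deriv_ge0_le _ (fun s => f (upd z d s)) (fun s => g (upd z d s))).
- exact: clip_mono.
- move=> r /andP[r1 r2]; apply: pfg; apply/andP; split.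
    exact: le_lt_trans r1.
  exact: lt_le_trans t2.
- apply: continuous_subspaceT; apply: line_continuous; exact: boxcont_ucont.
- move=> r /andP[r1 r2]; apply: g0; apply/andP; split.
    exact: le_lt_trans r1.
  exact: lt_le_trans t2.
Qed.

Lemma pdD d f f' g g' : pd d f f' -> pd d g g' ->
  pd d (fun z => f z + g z) (fun z => f' z + g' z).
Proof. by move=> h1 h2 z s hs; exact: is_deriveD (h1 z s hs) (h2 z s hs). Qed.

Lemma pdM d f f' g g' : pd d f f' -> pd d g g' ->
  pd d (fun z => f z * g z) (fun z => f' z * g z + f z * g' z).
Proof.
move=> h1 h2 z s hs.
apply: (is_derive_eq (is_deriveM (h1 z s hs) (h2 z s hs))).
by rewrite /GRing.scale/= addrC (mulrC (g _)).
Qed.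

Lemma pd_cst d (c : R) : pd d (fun=> c) (fun=> 0).
Proof. by move=> z s _; exact: is_derive_cst. Qed.

Lemma pdZ d f f' (c : R) : pd d f f' -> pd d (fun z => c * f z) (fun z => c * f' z).
Proof.
move=> h z s hs; have H := pdM (@pd_cst d c) h z hs; apply: (is_derive_eq H).
by rewrite mul0r add0r.
Qed.

Lemma pdB d f f' g g' : pd d f f' -> pd d g g' ->
  pd d (fun z => f z - g z) (fun z => f' z - g' z).
Proof. by move=> h1 h2 z s hs; exact: is_deriveB (h1 z s hs) (h2 z s hs). Qed.

Lemma boxcontD f g : boxcont f -> boxcont g -> boxcont (fun z => f z + g z).
Proof.
move=> [cf fc] [cg gc]; split; last by move=> z; rewrite fc gc.
by move=> z; exact: (continuousD (cf z) (cg z)).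
Qed.

Lemma boxcontM f g : boxcont f -> boxcont g -> boxcont (fun z => f z * g z).
Proof.
move=> [cf fc] [cg gc]; split; last by move=> z; rewrite fc gc.
by move=> z; exact: (continuousM (cf z) (cg z)).
Qed.

Lemma boxcont_cst (c : R) : boxcont (fun=> c).
Proof. by split; [exact: cst_continuous|]. Qed.

Lemma boxcontZ (c : R) f : boxcont f -> boxcont (fun z => c * f z).
Proof. by move=> bf; exact: (boxcontM (boxcont_cst c) bf). Qed.

Lemma boxcontB f g : boxcont f -> boxcont g -> boxcont (fun z => f z - g z).
Proof.
move=> [cf fc] [cg gc]; split; last by move=> z; rewrite fc gc.
by move=> z; exact: (continuousB (cf z) (cg z)).
Qed.

Lemma boxcont_updr f d s : boxcont f -> boxcont (fun z => f (upd z d s)).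
Proof.
move=> bf; split; last first.
  by move=> z; rewrite boxcont_upd// -clamp_upd; case: bf.
apply: ucont_continuous => e e0; have [k k0 H] := boxcont_ucont bf e0.
by exists k => // z z' zz'; apply: H; exact: close_upd.
Qed.

Lemma pd_eq0 d f g z s t : boxcont f -> pd d f g ->
  (forall r, lo d < r < hi d -> g (upd z d r) = 0) -> f (upd z d s) = f (upd z d t).
Proof.
move=> bf pfg g0.
wlog st : s t / s <= t.
  by move=> H; have [/H//|/ltW/H] := lerP s t.
apply/eqP; rewrite eq_le; apply/andP; split.
  by apply: pd_mono pfg _ st => // r /g0 ->.
rewrite -lerN2 -mulN1r -[leRHS]mulN1r.
apply: (@pd_mono d (fun z => -1 * f z) (fun z => -1 * g z)) => //.
- exact: boxcontZ.
- exact: pdZ.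
- by move=> r /g0 ->; rewrite mulr0.
Qed.

Definition prim d f z : R := prim1 (lo d) (hi d) (fun s => f (upd z d s)) (z 0 d).

Lemma prim_upd d f z c :
  prim d f (upd z d c) = prim1 (lo d) (hi d) (fun s => f (upd z d s)) c.
Proof.
rewrite /prim upd_same; congr (prim1 _ _ _ _).
by apply/funext => s; rewrite upd_upd.
Qed.

Lemma prim_lo d f z : prim d f (upd z d (lo d)) = 0.
Proof. by rewrite prim_upd prim1_a// ltW. Qed.

Lemma pd_prim d f : boxcont f -> pd d (prim d f) f.
Proof.
move=> bf z s hs.
rewrite (_ : (fun s => _) = prim1 (lo d) (hi d) (fun s => f (upd z d s))).
  by apply: prim1_der => //; apply: line_continuous; exact: boxcont_ucont.
by apply/funext => t; rewrite prim_upd.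
Qed.

Lemma prim_line_within d f z : boxcont f ->
  {within `[lo d, hi d], continuous (fun s => prim d f (upd z d s))}.
Proof.
move=> bf; rewrite (_ : (fun s => _) = prim1 (lo d) (hi d) (fun s => f (upd z d s))).
  apply: prim1_cont; first exact/ltW.
  by apply: line_continuous; exact: boxcont_ucont.
by apply/funext => t; rewrite prim_upd.
Qed.

Lemma prim_clamp d f z : boxcont f -> prim d f (clamp z) = prim d f z.
Proof.
move=> bf; rewrite /prim /prim1 clampE clip_clip ?(ltW (lohi d))//.
congr (fine (integral _ _ _)); apply/funext => s /=; congr (_%:E).
rewrite -bf.2 -[RHS]bf.2 !clamp_upd; congr (f _); congr (upd _ _ _).
exact: clamp_clamp.
Qed.

Lemma prim_clip d f z : boxcont f ->
  prim d f z = prim d f (upd z d (clip (lo d) (hi d) (z 0 d))).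
Proof.
move=> bf; rewrite prim_upd /prim /prim1 clip_clip//; exact/ltW.
Qed.

Lemma prim_bound d f z z' M : boxcont f ->
  (forall s, `|f (upd z d s) - f (upd z' d s)| <= M) ->
  forall c, lo d <= c <= hi d ->
  `|prim d f (upd z d c) - prim d f (upd z' d c)| <= M * (c - lo d).
Proof.
move=> bf H c /andP[c1 c2].
have := @deriv_bound _ (fun s => prim d f (upd z d s) - prim d f (upd z' d s))
  (fun s => f (upd z d s) - f (upd z' d s)) (lo d) c M c1.
rewrite !prim_lo !subr0; apply => //.
- move=> s /andP[s1 s2].
  have hs : lo d < s < hi d by rewrite s1 (lt_le_trans s2).
  by apply: is_deriveB; exact: pd_prim.
- apply: (@continuous_subspaceW _ _ _ `[lo d, hi d]).
    by move=> x /=; rewrite !in_itv/= => /andP[-> h]; exact: le_trans c2.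
  by apply: within_continuousB; exact: prim_line_within.
Qed.

(** The move from z to z' is split in two: the endpoint c moves to c' on the line through z, then
    the other coordinates move with c' fixed. *)
Lemma prim_boxcont d f : boxcont f -> boxcont (prim d f).
Proof.
move=> bf; split; last by move=> z; exact: prim_clamp.
have lh := lohi d.
move=> z; apply/(@cvgrPdist_lt _ _ _ _ (nbhs_filter z)) => e e0.
(* Integrating a difference of at most [e'] over at most the whole side costs at most e / 2. *)
pose e' := e / 2 / (hi d - lo d).
have e'0 : 0 < e' by rewrite !divr_gt0// subr_gt0.
have [k1 k10 H1] := boxcont_ucont bf e'0.
have cc : continuous (fun c => prim d f (upd z d (clip (lo d) (hi d) c))).
  apply: (continuous_within_comp (@prim_line_within d f z bf)).
    exact: clip_continuous.
  by move=> y /=; rewrite in_itv/= clip_itv// ltW.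
have e20 : 0 < e / 2 by rewrite divr_gt0.
have /cvgrPdist_lt/(_ _ e20)/nbhs_ballP[k2 /= k20 H2] := cc (z 0 d).
have k0 : 0 < Num.min k1 k2 by rewrite lt_min k10 k20.
apply/nbhs_ballP; exists (Num.min k1 k2) => //= z' /(ball_close _ _ k0) zz'.
rewrite (@prim_clip d f z)// (@prim_clip d f z')//.
set c := clip _ _ (z 0 d); set c' := clip _ _ (z' 0 d).
have h1 : `|prim d f (upd z d c) - prim d f (upd z d c')| < e / 2.
  by apply: H2; have := zz' d; rewrite lt_min => /andP[].
have h2 : `|prim d f (upd z d c') - prim d f (upd z' d c')| <= e / 2.
  have c'h : lo d <= c' <= hi d by rewrite clip_itv// ltW.
  apply: le_trans (@prim_bound d f z z' e' bf _ c' c'h) _.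
    move=> s; apply/ltW/H1; apply: close_upd => // j.
    by have := zz' j; rewrite lt_min => /andP[].
  rewrite /e' -mulrA ler_piMr// ?(ltW e20)// mulrC ler_pdivrMr ?subr_gt0// mul1r.
  by case/andP: c'h => _; lra.
rewrite -(subrK (prim d f (upd z d c')) (prim d f (upd z d c))) -addrA.
apply: le_lt_trans (ler_normD _ _) _.
by rewrite (splitr e) ltr_leD.
Qed.

Lemma prim_ftc d f g z : boxcont f -> boxcont g -> pd d f g ->
  prim d g z = f z - f (upd z d (lo d)).
Proof.
move=> bf bg fg.
have := @pd_eq0 d (fun z => f z - prim d g z) (fun z => g z - g z) z (z 0 d) (lo d).
rewrite upd_id prim_lo subr0 => H; rewrite -H.
- by rewrite subKr.
- by apply: boxcontB => //; exact: prim_boxcont.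
- by apply: pdB => //; exact: pd_prim.
- by move=> r _; rewrite subrr.
Qed.

Lemma prim_le d f g z : boxcont f -> boxcont g ->
  (forall z, f z <= g z) -> prim d f z <= prim d g z.
Proof.
move=> bf bg fg.
have [lz|zl] := lerP (lo d) (z 0 d).
  have := @pd_mono d (fun z => prim d g z - prim d f z) (fun z => g z - f z) z
    (lo d) (z 0 d).
  rewrite !prim_lo upd_id subr0 subr_ge0; apply => //.
  - by apply: boxcontB; exact: prim_boxcont.
  - by apply: pdB; exact: pd_prim.
  - by move=> r _; rewrite subr_ge0.
rewrite (@prim_clip d f)// (@prim_clip d g)//.
have -> : clip (lo d) (hi d) (z 0 d) = lo d.
  by rewrite /clip max_l// ge_min ltW.
by rewrite !prim_lo.
Qed.

(** Both sides have the same derivative in direction d and vanish on the face [lo d]; [prim_ftc]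
    then gives linearity without an integrability argument. *)
Lemma primD d f g z : boxcont f -> boxcont g ->
  prim d (fun z => f z + g z) z = prim d f z + prim d g z.
Proof.
move=> bf bg.
rewrite (@prim_ftc d (fun z => prim d f z + prim d g z)).
- by rewrite !prim_lo addr0 subr0.
- by apply: boxcontD; exact: prim_boxcont.
- exact: boxcontD.
- by apply: pdD; exact: pd_prim.
Qed.

Lemma primZ d f (c : R) z : boxcont f ->
  prim d (fun z => c * f z) z = c * prim d f z.
Proof.
move=> bf.
rewrite (@prim_ftc d (fun z => c * prim d f z)).
- by rewrite !prim_lo mulr0 subr0.
- by apply: boxcontZ; exact: prim_boxcont.
- exact: boxcontZ.
- by apply: pdZ; exact: pd_prim.
Qed.

(* Differentiation under the integral: by the mean value theorem the error of
   the difference quotient is bounded by the modulus of continuity of [g]. *)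
Lemma pd_prim_other d j f g : j != d -> boxcont f -> boxcont g ->
  pd j f g -> pd j (prim d f) (prim d g).
Proof.
move=> jd bf bg fg z s /andP[s1 s2].
have lh := lohi d; have lh0 : 0 < hi d - lo d by rewrite subr_gt0.
apply: is_derive_eps => e e0.
pose e' := e / (hi d - lo d).
have e'0 : 0 < e' by rewrite divr_gt0.
have [k1 k10 H1] := boxcont_ucont bg e'0.
(* Besides the modulus of continuity, k keeps s + h inside the open side, where [pd] applies. *)
pose k := Num.min k1 (Num.min (s - lo j) (hi j - s)).
exists k => [|h]; first by rewrite !lt_min k10 !subr_gt0 s1 s2.
rewrite !lt_min => /and3P[hk1 /ltr_normlP[hk2 hk3] /ltr_normlP[hk4 hk5]].
have slope c : `|f (upd (upd z d c) j (s + h)) - f (upd (upd z d c) j s)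
    - h * g (upd (upd z d c) j s)| <= e' * `|h|.
  set y := upd z d c.
  (* With the linear part removed, the derivative of [F] is an oscillation of g, hence at most [e']
     near s. *)
  pose F t := f (upd y j t) - t * g (upd y j s).
  pose dF t := g (upd y j t) - g (upd y j s).
  have dFF t : lo j < t < hi j -> is_derive t 1 F (dF t).
    move=> ht; apply: is_deriveB; first exact: fg.
    have : is_derive t 1 (fun t : R => t * g (upd y j s)) (t *: 0 + g (upd y j s) *: 1).
      exact: is_deriveM.
    move=> H; apply: (is_derive_eq H).
    by rewrite scaler0 add0r /GRing.scale/= mulr1.
  have cF : continuous F.
    move=> t; apply: cvgB; first by apply: line_continuous; exact: boxcont_ucont.
    by apply: cvgM; [exact: cvg_id|exact: cvg_cst].
  have bd t : `|t - s| < k1 -> `|dF t| <= e'.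
    move=> ts; apply/ltW/H1 => i; rewrite !updE; case: eqP => // _.
    by rewrite subrr normr0.
  have -> : f (upd y j (s + h)) - f (upd y j s) - h * g (upd y j s) = F (s + h) - F s.
    by rewrite /F; ring.
  have [h0|h0] := lerP 0 h.
    have -> : e' * `|h| = e' * (s + h - s) by rewrite (ger0_norm h0); ring.
    apply: (@deriv_bound _ F dF).
    - lra.
    - by move=> t /andP[t1 t2]; apply: dFF; apply/andP; split; lra.
    - exact: continuous_subspaceT.
    - move=> t /andP[t1 t2]; apply: bd; rewrite ger0_norm; last lra.
      by move: hk1; rewrite ger0_norm//; lra.
  have -> : e' * `|h| = e' * (s - (s + h)) by rewrite (ltr0_norm h0); ring.
  rewrite distrC; apply: (@deriv_bound _ F dF).
  - lra.
  - by move=> t /andP[t1 t2]; apply: dFF; apply/andP; split; lra.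
  - exact: continuous_subspaceT.
  - move=> t /andP[t1 t2]; apply: bd; rewrite ltr0_norm; last lra.
    by move: hk1; rewrite ltr0_norm//; lra.
have dj : d != j by rewrite eq_sym.
pose f1 := fun y => f (upd y j (s + h)) - f (upd y j s) - h * g (upd y j s).
have bf1 : boxcont f1.
  apply: boxcontB; last by apply: boxcontZ; exact: boxcont_updr.
  by apply: boxcontB; exact: boxcont_updr.
have primj q t : boxcont q -> prim d q (upd z j t) = prim d (fun y => q (upd y j t)) z.
  move=> bq; rewrite /prim updE (negbTE dj); congr (prim1 _ _ _ _).
  by apply/funext => c; rewrite updC// eq_sym.
rewrite !primj//.
have -> : prim d (fun y => f (upd y j (s + h))) z - prim d (fun y => f (upd y j s)) z -
   h * prim d (fun y => g (upd y j s)) z = prim d f1 z.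
  rewrite (@prim_ftc d (fun z => prim d (fun y => f (upd y j (s + h))) z -
     prim d (fun y => f (upd y j s)) z - h * prim d (fun y => g (upd y j s)) z) f1) => //.
  - by rewrite !prim_lo mulr0 !subr0.
  - apply: boxcontB; first by apply: boxcontB; apply: prim_boxcont; exact: boxcont_updr.
    by apply: boxcontZ; apply: prim_boxcont; exact: boxcont_updr.
  - apply: pdB; first by apply: pdB; apply: pd_prim; exact: boxcont_updr.
    by apply: pdZ; apply: pd_prim; exact: boxcont_updr.
rewrite prim_clip//; set c := clip _ _ _.
have ch : lo d <= c <= hi d by rewrite clip_itv// ltW.
have := @deriv_bound _ (fun s => prim d f1 (upd z d s)) (fun s => f1 (upd z d s))
  (lo d) c (e' * `|h|).
case/andP: ch => c1 c2; rewrite prim_lo subr0 => H.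
apply: le_trans (H c1 _ _ _) _.
- move=> t /andP[t1 t2]; apply: pd_prim => //; rewrite t1 /=; exact: lt_le_trans c2.
- apply: continuous_subspaceT; apply: line_continuous.
  by apply: boxcont_ucont; exact: prim_boxcont.
- by move=> t _; exact: slope.
- rewrite mulrAC ler_wpM2r// /e' mulrAC -mulrA ler_piMr ?(ltW e0)//.
  by rewrite ler_pdivrMr// mul1r lerD2r.
Qed.

(** A strict failure at a point of the box persists nearby by uniform continuity, hence at an
    interior point. *)
Lemma box_dense f g : boxcont f -> boxcont g ->
  (forall z, (forall j, lo j < z 0 j < hi j) -> f z <= g z) -> forall z, f z <= g z.
Proof.
move=> bf bg H z; rewrite leNgt; apply/negP => gf.
have h0 : 0 < f z - g z by rewrite subr_gt0.
have [k k0 Hk] := boxcont_ucont (boxcontB bf bg) h0.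
(* The margin k / 2 keeps the displaced point k-close; a quarter of the side keeps the shrunken box
   nonempty. *)
pose e j := Num.min (k / 2) ((hi j - lo j) / 4).
pose z' : pt := \row_j clip (lo j + e j) (hi j - e j) (clamp z 0 j).
have e0 j : 0 < e j by rewrite lt_min !divr_gt0// subr_gt0.
have ek j : e j <= k / 2 by rewrite ge_min lexx.
have el j : e j <= (hi j - lo j) / 4 by rewrite ge_min lexx orbT.
have z'in j : lo j < z' 0 j < hi j.
  have h : lo j + e j <= hi j - e j by have := el j; have := lohi j; lra.
  have /andP[h1 h2] := clip_itv (clamp z 0 j) h.
  by have := e0 j; rewrite [z' 0 j]mxE => ?; apply/andP; split; lra.
have cz : close k (clamp z) z'.
  move=> j; rewrite [z' 0 j]mxE; have /andP[c1 c2] := clamp_itv z j.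
  have := ek j; have := el j; have := e0 j; move: (clamp z 0 j) (e j) c1 c2 => c ej c1 c2 ej0 ej1 ej2.
  rewrite /clip ltr_norml; case: (lerP c (hi j - ej)) => ?;
    [case: (lerP (lo j + ej) c) => ?|case: (lerP (lo j + ej) (hi j - ej)) => ?];
    apply/andP; split; lra.
have := Hk _ _ cz; rewrite /= bf.2 bg.2.
have := H z' z'in; move=> h1 /ltr_normlP[h2 h3]; lra.
Qed.

Lemma box_dense_eq f g : boxcont f -> boxcont g ->
  (forall z, (forall j, lo j < z 0 j < hi j) -> f z = g z) -> f = g.
Proof.
move=> bf bg H; apply/funext => z; apply/eqP; rewrite eq_le.
by apply/andP; split; apply: box_dense => // y /H ->.
Qed.

(** [pd] determines the derivative in the interior only; continuity fixes it on the faces as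
    well. *)
Lemma pd_unique d f g g' : boxcont g -> boxcont g' ->
  pd d f g -> pd d f g' -> g = g'.
Proof.
move=> bg bg' h h'; apply: box_dense_eq => // z /(_ d) zd.
have := @derive_val _ _ _ _ _ _ _ (h z _ zd).
by rewrite (@derive_val _ _ _ _ _ _ _ (h' z _ zd)) upd_id.
Qed.

(* Integrating in direction [i] turns the symmetry of second derivatives into
   differentiation under the integral. *)
Lemma pd_swap i j f fi fj fij fji : i != j ->
  boxcont f -> boxcont fi -> boxcont fj -> boxcont fij -> boxcont fji ->
  pd i f fi -> pd j f fj -> pd j fi fij -> pd i fj fji -> fij = fji.
Proof.
move=> ij bf bfi bfj bfij bfji pfi pfj pfij pfji.
have ji : j != i by rewrite eq_sym.
have E : prim i fi = fun z => f z - f (upd z i (lo i)).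
  by apply/funext => z; exact: prim_ftc.
have E' : prim i fji = fun z => fj z - fj (upd z i (lo i)).
  by apply/funext => z; exact: prim_ftc.
have p1 : pd j (prim i fi) (prim i fij) by exact: pd_prim_other.
have p2 : pd j (prim i fi) (prim i fji).
  rewrite E E'; apply: pdB => // z s hs.
  have := pfj (upd z i (lo i)) s hs; rewrite updC//.
  by under [X in is_derive _ _ X]eq_fun do rewrite updC//.
have EE : prim i fij = prim i fji by apply: pd_unique p1 p2; exact: prim_boxcont.
by apply: (@pd_unique i (prim i fij)) => //; [|rewrite EE]; exact: pd_prim.
Qed.

(** The integral remains a function of all coordinates, constant in direction d. Iterated integrals
    thus stay in [boxcont], and the list fixes their order, so that no Fubini theorem is
    involved. *)
Definition Int d f z : R := prim d f (upd z d (hi d)).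
Definition IntL (l : seq 'I_m) f := foldr Int f l.

Lemma Int_boxcont d f : boxcont f -> boxcont (Int d f).
Proof. by move=> bf; apply: boxcont_updr; exact: prim_boxcont. Qed.

Lemma IntL_boxcont l f : boxcont f -> boxcont (IntL l f).
Proof. by move=> bf; elim: l => //= d l IH; exact: Int_boxcont. Qed.

Lemma IntL_le l f g : boxcont f -> boxcont g -> (forall z, f z <= g z) ->
  forall z, IntL l f z <= IntL l g z.
Proof.
move=> bf bg fg; elim: l => //= d l IH z.
by apply: prim_le => //; exact: IntL_boxcont.
Qed.

Lemma IntLD l f g : boxcont f -> boxcont g ->
  IntL l (fun z => f z + g z) = fun z => IntL l f z + IntL l g z.
Proof.
move=> bf bg; elim: l => //= d l ->; apply/funext => z.
by apply: primD; exact: IntL_boxcont.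
Qed.

Lemma IntLZ l f (c : R) : boxcont f ->
  IntL l (fun z => c * f z) = fun z => c * IntL l f z.
Proof.
move=> bf; elim: l => //= d l ->; apply/funext => z.
by apply: primZ; exact: IntL_boxcont.
Qed.

Lemma Int_ftc d f g : boxcont f -> boxcont g -> pd d f g ->
  Int d g = fun z => f (upd z d (hi d)) - f (upd z d (lo d)).
Proof.
by move=> bf bg fg; apply/funext => z; rewrite /Int (prim_ftc _ bf bg fg) upd_upd.
Qed.

Lemma pd_IntL i l f g : i \notin l -> boxcont f -> boxcont g -> pd i f g ->
  pd i (IntL l f) (IntL l g).
Proof.
move=> + bf bg fg; elim: l => //= d l IH; rewrite inE negb_or => /andP[id il].
have p := pd_prim_other id (IntL_boxcont l bf) (IntL_boxcont l bg) (IH il).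
move=> z s hs; have := p (upd z d (hi d)) s hs.
have di : d != i by rewrite eq_sym.
by rewrite /Int -updC//; under [X in is_derive _ _ X]eq_fun do rewrite -updC//.
Qed.

Lemma IntL_upd i l f c z : i \notin l ->
  IntL l f (upd z i c) = IntL l (fun y => f (upd y i c)) z.
Proof.
elim: l z => //= d l IH z; rewrite inE negb_or => /andP[id il].
rewrite /Int !prim_upd; congr (prim1 _ _ _ _).
by apply/funext => s; rewrite -IH// updC//.
Qed.

(* The derivative is moved outwards, under the integrals inside the one in
   direction [i], which then gives the difference of the values at the faces. *)
Lemma IntL_pd0 i l f g : uniq l -> i \in l -> boxcont f -> boxcont g -> pd i f g ->
  (forall z, f (upd z i (lo i)) = 0) -> (forall z, f (upd z i (hi i)) = 0) ->
  IntL l g = fun=> 0.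
Proof.
move=> + + bf bg fg f0 f1; elim: l => //= d l IH /andP[dl ul].
have IntL0 l' : IntL l' (fun=> 0) = fun=> 0.
  have := IntLZ l' 0 (boxcont_cst 0).
  by under eq_fun do rewrite mul0r; move=> ->; apply/funext => z; rewrite mul0r.
rewrite inE; case: eqVneq => [ed _|id /= /IH ->//].
  rewrite -ed in dl *; rewrite (@Int_ftc i (IntL l f)).
  - by apply/funext => z; rewrite !IntL_upd//;
      under eq_fun do rewrite f1;
      under [X in _ - IntL l X z]eq_fun do rewrite f0; rewrite IntL0 subr0.
  - exact: IntL_boxcont.
  - exact: IntL_boxcont.
  - exact: pd_IntL.
exact: (IntL0 [:: d]).
Qed.

Lemma coord_boxcont i : boxcont (fun z => clip (lo i) (hi i) (z 0 i)).
Proof.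
split; last by move=> y; rewrite clampE clip_clip// ltW.
by move=> y; apply: continuous_comp; [exact: coord_continuous|exact: clip_continuous].
Qed.

Lemma pd_coord d i :
  pd d (fun z => clip (lo i) (hi i) (z 0 i)) (fun=> (i == d)%:R).
Proof.
move=> z s /andP[s1 s2]; under [X in is_derive _ _ X]eq_fun do rewrite updE.
case: eqP => [->|_]; last exact: is_derive_cst.
apply: (@near_eq_is_derive _ R R id).
near=> t; rewrite clip_id//; apply/andP; split; apply: ltW; near: t.
  exact: lt_nbhsr.
exact: lt_nbhsl.
Unshelve. all: by end_near. Qed.

Lemma IntL_cst l (c : R) :
  IntL l (fun=> c) = fun=> c * \prod_(d <- l) (hi d - lo d).
Proof.
elim: l => [|d l IH] /=; first by rewrite big_nil mulr1.
rewrite IH big_cons mulrCA; set c' := c * _.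
rewrite (@Int_ftc d (fun z => c' * clip (lo d) (hi d) (z 0 d))).
- apply/funext => z; rewrite !upd_same !clip_id ?lexx ?(ltW (lohi d))//; ring.
- exact/boxcontZ/coord_boxcont.
- exact: boxcont_cst.
- move=> y s hs; have H := pdZ c' (@pd_coord d d) y hs; apply: (is_derive_eq H).
  by rewrite eqxx mulr1.
Qed.

End Box.

(** * Weighted energy estimates *)

Section Expr.
Context {R : realType} {m : nat} (lo hi : 'I_m -> R).
Hypothesis lohi : forall d, lo d < hi d.
Notation pt := 'rV[R]_m.
Notation boxcont := (boxcont lo hi).
Notation pd := (pd lo hi).
Context {A : Type} (at_ : A -> pt -> R) (dA : 'I_m -> A -> A).
Hypothesis at_boxcont : forall a, boxcont (at_ a).
Hypothesis at_pd : forall d a, pd d (at_ a) (at_ (dA d a)).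

(* With derivatives computed symbolically by [D], regularity is automatic and
   the energy identities reduce to polynomial identities between values. *)
Inductive expr := Atom of A | Cst of R | X of 'I_m | Add of expr & expr
  | Mul of expr & expr.

Fixpoint ev (e : expr) (z : pt) : R :=
  match e with
  | Atom a => at_ a z
  | Cst c => c
  | X i => clip (lo i) (hi i) (z 0 i)
  | Add e f => ev e z + ev f z
  | Mul e f => ev e z * ev f z
  end.

Fixpoint D (d : 'I_m) (e : expr) : expr :=
  match e with
  | Atom a => Atom (dA d a)
  | Cst c => Cst 0
  | X i => Cst (i == d)%:R
  | Add e f => Add (D d e) (D d f)
  | Mul e f => Add (Mul (D d e) f) (Mul e (D d f))
  end.

Lemma ev_boxcont e : boxcont (ev e).
Proof.
elim: e => //=.
- by move=> c; exact: boxcont_cst.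
- by move=> i; exact: coord_boxcont.
- by move=> e he f hf; exact: boxcontD.
- by move=> e he f hf; exact: boxcontM.
Qed.

Lemma ev_pd d e : pd d (ev e) (ev (D d e)).
Proof.
elim: e => //=.
- by move=> c; exact: pd_cst.
- by move=> i; exact: pd_coord.
- by move=> e he f hf; exact: pdD.
- by move=> e he f hf; exact: pdM.
Qed.

(** [D] acts on syntax, yet identities between values may be differentiated, because the derivative
    is determined by the function. *)
Lemma ev_D_ext d e f : ev e = ev f -> ev (D d e) = ev (D d f).
Proof.
move=> ef; have p := @ev_pd d f; rewrite -ef in p.
exact: (pd_unique lohi (ev_boxcont _) (ev_boxcont _) (@ev_pd d e) p).
Qed.

Lemma ev_DC i j e : ev (D i (D j e)) = ev (D j (D i e)).
Proof.
have [->//|ij] := eqVneq i j.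
have h := pd_swap lohi ij (ev_boxcont e) (ev_boxcont (D i e)) (ev_boxcont (D j e))
  (ev_boxcont (D j (D i e))) (ev_boxcont (D i (D j e))).
by rewrite h//; exact: ev_pd.
Qed.

Lemma ev_const d e z s t : ev (D d e) = (fun=> 0) -> ev e (upd z d s) = ev e (upd z d t).
Proof.
move=> h; apply: (pd_eq0 lohi _ _ (ev_boxcont e) (@ev_pd d e)) => r _.
by rewrite h.
Qed.

Definition esum (l : seq 'I_m) (F : 'I_m -> expr) :=
  foldr (fun i e => Add (F i) e) (Cst 0) l.

Lemma ev_esum l F z : ev (esum l F) z = \sum_(i <- l) ev (F i) z.
Proof. by elim: l => [|i l IH] /=; rewrite ?big_nil// big_cons -IH. Qed.

Lemma D_esum d l F : D d (esum l F) = esum l (fun i => D d (F i)).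
Proof. by elim: l => //= i l ->. Qed.

Lemma ev_esum_ext l F G : (forall i, ev (F i) = ev (G i)) -> ev (esum l F) = ev (esum l G).
Proof.
move=> FG; apply/funext => z; rewrite !ev_esum.
by apply: eq_bigr => i _; rewrite FG.
Qed.

Variables (t : 'I_m) (sp : seq 'I_m).
Hypotheses (uniq_sp : uniq sp) (tsp : t \notin sp).

Definition lap e := esum sp (fun i => D i (D i e)).

Lemma ev_lap_ext e f : ev e = ev f -> ev (lap e) = ev (lap f).
Proof. by move=> ef; apply: ev_esum_ext => i; do 2 apply: ev_D_ext. Qed.

Lemma ev_D_lap d e : ev (D d (lap e)) = ev (lap (D d e)).
Proof.
rewrite /lap D_esum; apply: ev_esum_ext => i.
by rewrite ev_DC; apply: ev_D_ext; exact: ev_DC.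
Qed.

Lemma lap_Add e f : ev (lap (Add e f)) = ev (Add (lap e) (lap f)).
Proof.
apply/funext => z /=; rewrite !ev_esum -big_split.
by apply: eq_bigr.
Qed.

(** In [stint] the time integral is innermost: a space derivative passes out through it, and a time
    derivative is integrated at once. *)
Definition spint (s : R) e : pt -> R := IntL lo hi sp (fun z => ev e (upd z t s)).
Definition stint e : pt -> R := IntL lo hi sp (Int lo hi t (ev e)).

Lemma Int_ev_boxcont d e : boxcont (Int lo hi d (ev e)).
Proof. by apply: Int_boxcont => //; exact: ev_boxcont. Qed.

Lemma stint_le e f z0 : (forall z, ev e z <= ev f z) -> stint e z0 <= stint f z0.
Proof.
move=> ef; apply: IntL_le => //; first exact: Int_ev_boxcont.
  exact: Int_ev_boxcont.
by apply: (IntL_le lohi [:: t]) => //; exact: ev_boxcont.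
Qed.

Lemma stint_ext e f : ev e = ev f -> stint e = stint f.
Proof. by rewrite /stint => ->. Qed.

Lemma stintD e f z0 : stint (Add e f) z0 = stint e z0 + stint f z0.
Proof.
rewrite /stint; have -> : Int lo hi t (ev (Add e f)) =
    fun z => Int lo hi t (ev e) z + Int lo hi t (ev f) z.
  exact: (IntLD lohi [:: t] (ev_boxcont e) (ev_boxcont f)).
by rewrite IntLD//; exact: Int_ev_boxcont.
Qed.

Lemma stintZ c e z0 : stint (Mul (Cst c) e) z0 = c * stint e z0.
Proof.
rewrite /stint; have -> : Int lo hi t (ev (Mul (Cst c) e)) =
    fun z => c * Int lo hi t (ev e) z.
  exact: (IntLZ lohi [:: t] c (ev_boxcont e)).
by rewrite IntLZ//; exact: Int_ev_boxcont.
Qed.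

Definition box_volume : R := (hi t - lo t) * \prod_(i <- sp) (hi i - lo i).

Lemma stint_cst c z0 : stint (Cst c) z0 = c * box_volume.
Proof.
have := IntL_cst lohi [:: t] c; rewrite /stint /= => ->.
by rewrite (IntL_cst lohi) big_cons big_nil mulr1 mulrA.
Qed.

Lemma stint_esum l F z0 : stint (esum l F) z0 = \sum_(i <- l) stint (F i) z0.
Proof.
elim: l => [|i l IH] /=; first by rewrite stint_cst mul0r big_nil.
by rewrite big_cons stintD IH.
Qed.

(** The divergence theorem without boundary term; it licenses every integration by parts below. *)
Lemma stint_space i e : i \in sp -> (forall z, ev e (upd z i (lo i)) = 0) ->
  (forall z, ev e (upd z i (hi i)) = 0) -> stint (D i e) = fun=> 0.
Proof.
move=> isp e0 e1; have it : i != t by apply: contraNneq tsp => <-.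
apply: (@IntL_pd0 _ _ _ _ lohi i sp (Int lo hi t (ev e))) => //.
- exact: Int_ev_boxcont.
- exact: Int_ev_boxcont.
- by apply: (pd_IntL lohi (l := [:: t])); rewrite ?inE//; [exact: ev_boxcont|exact: ev_boxcont|exact: ev_pd].
- move=> z; have := @IntL_upd _ _ lo hi i [:: t] (ev e) (lo i) z.
  rewrite inE it /= => /(_ isT) ->.
  under eq_fun do rewrite e0.
  by have := IntL_cst lohi [:: t] 0; rewrite /= => ->; rewrite mul0r.
- move=> z; have := @IntL_upd _ _ lo hi i [:: t] (ev e) (hi i) z.
  rewrite inE it /= => /(_ isT) ->.
  under eq_fun do rewrite e1.
  by have := IntL_cst lohi [:: t] 0; rewrite /= => ->; rewrite mul0r.
Qed.

Lemma stint_time e z0 : stint (D t e) z0 = spint (hi t) e z0 - spint (lo t) e z0.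
Proof.
rewrite /stint /spint (Int_ftc lohi (ev_boxcont e) (ev_boxcont _) (@ev_pd t e)).
have b s : boxcont (fun z => ev e (upd z t s)) by apply: boxcont_updr => //; exact: ev_boxcont.
have -> : (fun z => ev e (upd z t (hi t)) - ev e (upd z t (lo t))) =
   (fun z => ev e (upd z t (hi t)) + (-1) * ev e (upd z t (lo t))).
  by apply/funext => z; rewrite mulN1r.
rewrite IntLD//; last exact: boxcontZ.
by rewrite IntLZ// mulN1r.
Qed.

Lemma spint_le s e f z0 : (forall z, ev e (upd z t s) <= ev f (upd z t s)) ->
  spint s e z0 <= spint s f z0.
Proof.
by move=> ef; apply: IntL_le => //; apply: boxcont_updr => //; exact: ev_boxcont.
Qed.

Lemma spint_cst s c z0 : spint s (Cst c) z0 = c * \prod_(i <- sp) (hi i - lo i).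
Proof. by rewrite /spint /= IntL_cst. Qed.


Hypothesis space_itv : forall i, i \in sp -> lo i = -1 /\ hi i = 1.

Definition qx i := Add (Cst 1) (Mul (Cst (-1)) (Mul (X i) (X i))).
Definition bump (l : seq 'I_m) := foldr (fun i e => Mul (qx i) e) (Cst 1) l.
Notation psi := (bump sp).
Definition pw k := iter k (Mul psi) (Cst 1).

Lemma X_itv i z : i \in sp -> -1 <= ev (X i) z <= 1.
Proof.
move=> isp /=; have [<- <-] := space_itv isp.
by rewrite clip_itv// ltW.
Qed.

Lemma qx_itv i z : i \in sp -> 0 <= ev (qx i) z <= 1.
Proof.
move=> isp; have /= := X_itv z isp; move: (clip _ _ _) => x /andP[x1 x2].
by apply/andP; split; nra.
Qed.

Lemma bump_itv l z : {subset l <= sp} -> 0 <= ev (bump l) z <= 1.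
Proof.
elim: l => [|i l IH] sl; first by rewrite /= ler01 lexx.
have /andP[h1 h2] : 0 <= ev (bump l) z <= 1.
  by apply: IH => j jl; apply: sl; rewrite inE jl orbT.
have /andP[q1 q2] : 0 <= ev (qx i) z <= 1 by apply: qx_itv; apply: sl; rewrite inE eqxx.
by rewrite [ev _ _]/=; apply/andP; split; [exact: mulr_ge0|exact: mulr_ile1].
Qed.

Lemma D_bump_notin i l : i \notin l -> ev (D i (bump l)) = fun=> 0.
Proof.
elim: l => [|j l IH] //=; rewrite inE negb_or => /andP[ij il].
apply/funext => z; rewrite (IH il) eq_sym (negbTE ij) /=; ring.
Qed.

Lemma DD_bump_notin i l : i \notin l -> ev (D i (D i (bump l))) = fun=> 0.
Proof.
by move=> il; rewrite (@ev_D_ext i (D i (bump l)) (Cst 0)) ?D_bump_notin.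
Qed.

Lemma D_bump_le i l z : uniq l -> {subset l <= sp} -> i \in l ->
  `|ev (D i (bump l)) z| <= 2.
Proof.
elim: l => [|j l IH] //= /andP[jl ul] sl.
have sl' : {subset l <= sp} by move=> k kl; apply: sl; rewrite inE kl orbT.
have jsp : j \in sp by apply: sl; rewrite inE eqxx.
have /andP[b1 b2] := bump_itv z sl'.
have /= /andP[q1 q2] := qx_itv z jsp.
have /= /andP[x1 x2] := X_itv z jsp.
rewrite inE; case: eqVneq => [-> _|ij /= il].
  rewrite D_bump_notin// ?eqxx /=.
  move: (ev (bump l) z) (clip _ _ _) b1 b2 x1 x2 => b x b1 b2 x1 x2.
  by rewrite ler_norml; apply/andP; split; nra.
rewrite ?[j == i]eq_sym ?(negbTE ij) /=.
have /ler_normlP[h1 h2] := IH ul sl' il.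
move: q1 q2 h1 h2; set q := 1 + _; move: (ev (D i _) z) => y q1 q2 h1 h2.
by rewrite ler_norml; apply/andP; split; nra.
Qed.

Lemma DD_bump_le i l z : uniq l -> {subset l <= sp} -> i \in l ->
  `|ev (D i (D i (bump l))) z| <= 2.
Proof.
elim: l => [|j l IH] //= /andP[jl ul] sl.
have sl' : {subset l <= sp} by move=> k kl; apply: sl; rewrite inE kl orbT.
have jsp : j \in sp by apply: sl; rewrite inE eqxx.
have /andP[b1 b2] := bump_itv z sl'.
have /= /andP[q1 q2] := qx_itv z jsp.
rewrite inE; case: eqVneq => [-> _|ij /= il].
  rewrite D_bump_notin// DD_bump_notin// ?eqxx /=.
  move: (ev (bump l) z) (clip _ _ _) b1 b2 => b x b1 b2.
  by rewrite ler_norml; apply/andP; split; nra.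
rewrite ?[j == i]eq_sym ?(negbTE ij) /=.
have /ler_normlP[h1 h2] := IH ul sl' il.
move: q1 q2 h1 h2; set q := 1 + _; move: (ev (D i (D i _)) z) => y q1 q2 h1 h2.
by rewrite ler_norml; apply/andP; split; nra.
Qed.

Lemma ev_pw k z : ev (pw k) z = ev psi z ^+ k.
Proof. by elim: k => [|k IH] /=; rewrite ?expr0// exprS -IH. Qed.

Lemma psi_ge0 z : 0 <= ev psi z.
Proof. by have /andP[] := bump_itv z (fun x => id). Qed.

Lemma psi_le1 z : ev psi z <= 1.
Proof. by have /andP[] := bump_itv z (fun x => id). Qed.

Lemma D_pw i k :
  ev (D i (pw k.+1)) = ev (Mul (Cst k.+1%:R) (Mul (pw k) (D i psi))).
Proof.
apply/funext => z; elim: k => [|k IH]; first by rewrite /=; ring.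
have -> : ev (D i (pw k.+2)) z =
    ev (D i psi) z * ev (pw k.+1) z + ev psi z * ev (D i (pw k.+1)) z by [].
rewrite IH [ev (Mul _ _) z]/= [ev (Mul _ _) z]/= (ev_pw k.+1) ev_pw (natrD _ 1 k.+1) exprS; ring.
Qed.

(** The bound keeps the weight psi^k instead of a mere constant: it is these remaining powers that
    are shared out in [absorb]. *)
Lemma D_pw_le i k z : i \in sp ->
  `|ev (D i (pw k.+1)) z| <= 2 * k.+1%:R * ev psi z ^+ k.
Proof.
move=> isp; rewrite D_pw [ev _ _]/= ev_pw !normrM ger0_norm// ger0_norm ?exprn_ge0 ?psi_ge0//.
have := D_bump_le z uniq_sp (fun x => id) isp.
move: (`|ev _ z|) => y y2.
rewrite (mulrC 2) -mulrA ler_wpM2l// mulrC ler_wpM2r// exprn_ge0// psi_ge0//.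
Qed.

Lemma DD_pw_le i k z : i \in sp ->
  `|ev (D i (D i (pw k.+2))) z| <= 4 * k.+2%:R ^+ 2 * ev psi z ^+ k.
Proof.
move=> isp; rewrite (ev_D_ext i (D_pw i k.+1)).
have -> : ev (D i (Mul (Cst k.+2%:R) (Mul (pw k.+1) (D i psi)))) z =
  k.+2%:R * (ev (D i (pw k.+1)) z * ev (D i psi) z + ev (pw k.+1) z * ev (D i (D i psi)) z).
  by rewrite /=; ring.
have h1 := D_pw_le k z isp.
have h2 := D_bump_le z uniq_sp (fun x => id) isp.
have h3 := DD_bump_le z uniq_sp (fun x => id) isp.
have p0 := psi_ge0 z; have p1 := psi_le1 z.
rewrite normrM ger0_norm// ev_pw.
have P0 : 0 <= ev psi z ^+ k by rewrite exprn_ge0.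
have h4 : `|ev psi z ^+ k.+1 * ev (D i (D i psi)) z| <= 2 * ev psi z ^+ k.
  rewrite normrM ger0_norm ?exprn_ge0// exprSr -mulrA (mulrC 2) ler_wpM2l//.
  by rewrite -[2]mul1r ler_pM.
have h5 : `|ev (D i (pw k.+1)) z * ev (D i psi) z| <= 4 * k.+1%:R * ev psi z ^+ k.
  rewrite normrM; apply: le_trans (_ : 2 * k.+1%:R * ev psi z ^+ k * 2 <= _).
    by rewrite ler_pM.
  by rewrite le_eqVlt; apply/orP; left; apply/eqP; ring.
rewrite (_ : 4 * _ ^+ 2 * _ = k.+2%:R * (4 * k.+2%:R * ev psi z ^+ k)); last by ring.
rewrite ler_wpM2l//.
apply: le_trans (ler_normD _ _) _; apply: le_trans (lerD h5 h4) _.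
rewrite (natrD _ 1 k.+1); nra.
Qed.

Lemma psi_face i c z : i \in sp -> c = lo i \/ c = hi i -> ev psi (upd z i c) = 0.
Proof.
move=> isp; have [l1 h1] := space_itv isp.
have lh := ltW (lohi i).
rewrite l1 h1 => hc.
have qi : ev (qx i) (upd z i c) = 0.
  rewrite /= upd_same clip_id; last by rewrite l1 h1; case: hc => ->; lra.
  by case: hc => ->; ring.
elim: (sp) isp => //= j l IH; rewrite inE => /orP[/eqP<-|/IH ->]; last by rewrite mulr0.
by move: qi => /= ->; rewrite mul0r.
Qed.

(** Young's inequality with the common weight P, by completing a square; the rest r * s of the
    weight is split, r going to y and s to x. *)
Lemma absorb (P c r s x y w d : R) : 0 <= P -> 0 < d ->
  `|w| <= P * (c * (r * s)) -> 0 <= r -> 0 <= s ->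
  w * (x * y) <= P * (d * (r * y) ^+ 2 + c ^+ 2 / (4 * d) * (s * x) ^+ 2).
Proof.
move=> P0 d0 wP r0 s0.
apply: le_trans (ler_norm _) _; rewrite !normrM.
apply: le_trans (_ : P * (c * (r * s)) * (`|x| * `|y|) <= _).
  by rewrite ler_wpM2r// mulr_ge0.
rewrite -mulrA ler_wpM2l//.
have -> : (r * y) ^+ 2 = (r * `|y|) ^+ 2 by rewrite !exprMn real_normK// num_real.
have -> : (s * x) ^+ 2 = (s * `|x|) ^+ 2 by rewrite !exprMn real_normK// num_real.
rewrite -subr_ge0.
have -> : d * (r * `|y|) ^+ 2 + c ^+ 2 / (4 * d) * (s * `|x|) ^+ 2 -
  c * (r * s) * (`|x| * `|y|) = (2 * d * (r * `|y|) - c * (s * `|x|)) ^+ 2 / (4 * d).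
  by field; rewrite gt_eqF.
by rewrite divr_ge0 ?sqr_ge0// mulr_ge0// ltW.
Qed.

(** * Weighted energy inequalities *)

Section Energy.
Variable z0 : pt.
Notation J e := (stint e z0).

Definition sqw k f := Mul (pw k) (Mul f f).
Notation E k f := (stint (sqw k f) z0).
Notation N := ((size sp)%:R : R).

Lemma ev_sqw k f z : ev (sqw k f) z = ev psi z ^+ k * (ev f z * ev f z).
Proof. by rewrite /sqw /= ev_pw. Qed.

Lemma sum_spE (c : R) : \sum_(i <- sp) c = N * c.
Proof. by rewrite big_const_seq count_predT iter_addr_0 mulr_natl. Qed.

(* Integrate [D i (psi^(k+2) f D_i f)] over space-time and absorb. *)
Lemma energy_gradient k f eps : 0 < eps ->
  \sum_(i <- sp) E k.+2 (D i f) <=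
  2 * eps * E k.+4 (lap f) + (4 * k.+2%:R ^+ 2 * N + (2 * eps)^-1) * E k f.
Proof.
move=> eps0.
pose e i := Mul (pw k.+2) (Mul f (D i f)).
(* [absorb] with d = 1/2 and c = 2 (k + 2) produces c^2 / (4 d) = [cc]; the other half of the
   squared derivative survives in [L]. *)
pose cc : R := 2 * k.+2%:R ^+ 2.
pose L i := Add (Mul (Cst 2^-1) (sqw k.+2 (D i f)))
  (Add (Mul (pw k.+2) (Mul f (D i (D i f)))) (Mul (Cst (- cc)) (sqw k f))).
have He i : i \in sp -> J (D i (e i)) = 0.
  move=> isp; rewrite stint_space// => z; rewrite [ev _ _]/= psi_face ?mul0r//.
    by left.
  by right.
have HL i : i \in sp -> J (L i) <= 0.
  move=> isp; rewrite -(He i isp); apply: stint_le => z.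
  have -> : ev (L i) z = 2^-1 * ev (sqw k.+2 (D i f)) z +
    (ev (pw k.+2) z * (ev f z * ev (D i (D i f)) z) + - cc * ev (sqw k f) z) by [].
  have -> : ev (D i (e i)) z = ev (D i (pw k.+2)) z * (ev f z * ev (D i f) z) +
    ev (pw k.+2) z * (ev (D i f) z * ev (D i f) z + ev f z * ev (D i (D i f)) z) by [].
  have := D_pw_le k.+1 z isp.
  have p0 := psi_ge0 z.
  rewrite !ev_sqw !ev_pw.
  have -> : ev psi z ^+ k.+2 = ev psi z ^+ k * ev psi z ^+ 2 by rewrite -exprD addn2.
  have P0 : 0 <= ev psi z ^+ k by rewrite exprn_ge0.
  move: (ev (D i (pw _)) z) => w hw.
  have hw' : `|- w| <= ev psi z ^+ k * (2 * k.+2%:R * (ev psi z * 1)).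
    by rewrite normrN mulr1 mulrCA -exprSr.
  have := @absorb _ _ _ _ (ev f z) (ev (D i f) z) _ (2^-1) P0 _ hw' p0 ler01.
  rewrite invr_gt0 ltr0n => /(_ isT).
  have -> : (2 * k.+2%:R) ^+ 2 / (4 * 2^-1) = cc by rewrite /cc; field.
  move: (ev psi z) (ev psi z ^+ k) => p P; rewrite mul1r !expr2; nra.
have Hsum : \sum_(i <- sp) J (L i) <= 0.
  by rewrite big_seq; apply: sumr_le0.
have EL i : J (L i) = 2^-1 * E k.+2 (D i f) + (J (Mul (pw k.+2) (Mul f (D i (D i f)))) - cc * E k f).
  by rewrite /L !stintD !stintZ mulNr.
(* After summation over i the second derivatives form f * [lap f]; its weight psi^(k+2) is the
   geometric mean of psi^k and psi^(k+4). *)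
have : J (Add (Mul (Cst (- eps)) (sqw k.+4 (lap f))) (Mul (Cst (- (4 * eps)^-1)) (sqw k f)))
  <= J (esum sp (fun i => Mul (pw k.+2) (Mul f (D i (D i f))))).
  apply: stint_le => z; rewrite ev_esum.
  have -> : \sum_(i <- sp) ev (Mul (pw k.+2) (Mul f (D i (D i f)))) z =
    ev psi z ^+ k.+2 * (ev f z * ev (lap f) z).
    by rewrite /lap ev_esum !mulr_sumr; apply: eq_bigr => i _;
      rewrite -[LHS]/(ev (pw k.+2) z * (ev f z * ev (D i (D i f)) z)) ev_pw.
  rewrite -[leLHS]/(- eps * ev (sqw k.+4 (lap f)) z +
    - (4 * eps)^-1 * ev (sqw k f) z) !ev_sqw.
  have p0 := psi_ge0 z.
  have P0 : 0 <= ev psi z ^+ k by rewrite exprn_ge0.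
  have hw : `|- ev psi z ^+ k.+2| <= ev psi z ^+ k * (1 * (ev psi z ^+ 2 * 1)).
    by rewrite normrN ger0_norm ?exprn_ge0// mulr1 mul1r -exprD addn2.
  have := @absorb _ _ _ _ (ev f z) (ev (lap f) z) _ eps P0 eps0 hw _ ler01.
  rewrite exprn_ge0// => /(_ isT).
  rewrite !mul1r expr1n -subr_ge0 => h; rewrite -subr_ge0; apply: le_trans h _.
  rewrite le_eqVlt; apply/orP; left; apply/eqP.
  rewrite !exprS expr0; move: (ev psi z) (ev psi z ^+ k) => p P; field.
  by rewrite gt_eqF.
rewrite stintD !stintZ stint_esum => H2.
move: Hsum; rewrite (eq_bigr _ (fun i _ => EL i)) big_split sumrB -mulr_sumr sum_spE /=.
move: H2; move: (\sum_(i <- sp) E k.+2 _) (\sum_(i <- sp) J _) => a b H2 H1.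
have -> : (2 * eps)^-1 = 2 * (4 * eps)^-1 :> R by field; rewrite gt_eqF.
move: ((4 * eps)^-1) H2 => ie H2.
have -> : 4 * k.+2%:R ^+ 2 = 2 * cc by rewrite /cc; ring.
move: H1 H2; move: (E k f) (E k.+4 (lap f)) => F H; nra.
Qed.

(** The summand 1 comes from 2 f (source f) <= f^2 + (source f)^2, the next from second derivatives
    of the weight, and the last from its first derivatives: these leave a gradient term with
    coefficient K / 2, to which [energy_gradient] is applied. *)
Definition energy_cst k : R := 
  let K := 64 * (N + 1) * (2 * k.+4%:R) ^+ 2 in
  1 + 2 * (N + 1) * N * (8 * k.+4%:R ^+ 2) ^+ 2
  + K / 2 * (4 * k.+2%:R ^+ 2 * N + K).

(* The right-hand side of the equation [d_t f + Delta^2 f = source f]. *)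
Definition source f := Add (D t f) (lap (lap f)).

Lemma D_pw_time k : ev (D t (pw k)) = fun=> 0.
Proof.
case: k => // k; rewrite D_pw; apply/funext => z /=.
by rewrite D_bump_notin// !mulr0.
Qed.

(* Integrate the time derivative of [psi^(k+4) f^2], moving two derivatives of
   the bilaplacian onto [psi^(k+4) f]. *)
Lemma energy_evolution k f :
  spint (hi t) (sqw k.+4 f) z0 + E k.+4 (lap f) <=
  spint (lo t) (sqw k.+4 f) z0 + energy_cst k * E k f + E k (source f).
Proof.
pose h := lap f; pose w := pw k.+4.
pose a i := Mul (Mul w f) (D i h).
pose b i := Mul (D i (Mul w f)) h.
(* Green's identity: D_i ([a i]) - D_i ([b i]) = w f D_i D_i h - D_i D_i (w f) h, the products of
   first derivatives cancelling. The factor 2 matches the time derivative of f^2. *)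
pose G i := Add (Mul (Cst 2) (D i (a i))) (Mul (Cst (-2)) (D i (b i))).
have face0 i c z : i \in sp -> c = lo i \/ c = hi i ->
    ev (a i) (upd z i c) = 0 /\ ev (b i) (upd z i c) = 0.
  move=> isp hc; have p0 := psi_face z isp hc; split.
    by rewrite /a /w [ev _ _]/= p0 !mul0r.
  have Dw : ev (D i w) (upd z i c) = 0.
    have := D_pw_le k.+3 (upd z i c) isp.
    by rewrite p0 exprS mul0r mulr0 normr_le0 => /eqP.
  have ww : ev w (upd z i c) = 0 by rewrite /w [ev _ _]/= p0 mul0r.
  have -> : ev (b i) (upd z i c) = (ev (D i w) (upd z i c) * ev f (upd z i c) +
     ev w (upd z i c) * ev (D i f) (upd z i c)) * ev h (upd z i c) by [].
  by rewrite Dw ww !mul0r addr0 mul0r.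
have JG i : i \in sp -> J (G i) = 0.
  move=> isp; rewrite stintD !stintZ !stint_space//.
  - by rewrite !mulr0 addr0.
  - by move=> z; case: (face0 i (lo i) z isp (or_introl erefl)).
  - by move=> z; case: (face0 i (hi i) z isp (or_intror erefl)).
  - by move=> z; case: (face0 i (lo i) z isp (or_introl erefl)).
  - by move=> z; case: (face0 i (hi i) z isp (or_intror erefl)).
(* With this d the N error terms in h^2 add up to at most 1/4 of the weighted h^2. *)
pose d : R := (8 * (N + 1))^-1.
have N0 : 0 <= N by [].
have d0 : 0 < d by rewrite invr_gt0; lra.
pose c2 : R := 8 * k.+4%:R ^+ 2.
pose c1 : R := 4 * (2 * k.+4%:R).
have G_le i z : i \in sp -> ev (G i) z <=
   2 * ev w z * (ev f z * ev (D i (D i h)) z) - 2 * ev w z * (ev h z * ev (D i (D i f)) z)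
   + ev psi z ^+ k * (2 * d * (ev psi z ^+ 2 * ev h z) ^+ 2
     + c2 ^+ 2 / (4 * d) * ev f z ^+ 2 + c1 ^+ 2 / (4 * d) * (ev psi z * ev (D i f) z) ^+ 2).
  move=> isp.
  have -> : ev (G i) z = 2 * ev w z * (ev f z * ev (D i (D i h)) z)
     - 2 * ev w z * (ev h z * ev (D i (D i f)) z)
     + ((- 2 * ev (D i (D i w)) z) * (ev f z * ev h z)
       + (- 4 * ev (D i w) z) * (ev (D i f) z * ev h z)).
    have -> : ev (G i) z = 2 * (ev (D i (Mul w f)) z * ev (D i h) z + ev w z * ev f z * ev (D i (D i h)) z)
      + -2 * (ev (D i (D i (Mul w f))) z * ev h z + ev (D i (Mul w f)) z * ev (D i h) z) by [].
    have -> : ev (D i (D i (Mul w f))) z =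
      (ev (D i (D i w)) z * ev f z + ev (D i w) z * ev (D i f) z) +
      (ev (D i w) z * ev (D i f) z + ev w z * ev (D i (D i f)) z) by [].
    ring.
  rewrite lerD2l.
  have p0 := psi_ge0 z.
  have P0 : 0 <= ev psi z ^+ k by rewrite exprn_ge0.
  have p20 : 0 <= ev psi z ^+ 2 by rewrite exprn_ge0.
  have h2 : `|- 2 * ev (D i (D i w)) z| <= ev psi z ^+ k * (c2 * (ev psi z ^+ 2 * 1)).
    rewrite normrM normrN (ger0_norm (ler0n _ 2)) mulr1.
    have := DD_pw_le k.+2 z isp; rewrite !exprS /c2 -/w => hh.
    rewrite (_ : _ * (_ * _) = 2 * (4 * (k.+4%:R * k.+4%:R ^+ 1) * (ev psi z * (ev psi z * ev psi z ^+ k)))).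
      by rewrite ler_wpM2l//; move: hh; rewrite ?expr0 ?expr1 ?mulr1.
    by rewrite ?expr0 ?expr1 ?mulr1; ring.
  have h1 : `|- 4 * ev (D i w) z| <= ev psi z ^+ k * (c1 * (ev psi z ^+ 2 * ev psi z)).
    rewrite normrM normrN (ger0_norm (ler0n _ 4)).
    have := D_pw_le k.+3 z isp; rewrite !exprS /c1 -/w => hh.
    rewrite (_ : _ * (_ * _) = 4 * (2 * k.+4%:R * (ev psi z * (ev psi z * (ev psi z * ev psi z ^+ k))))).
      by rewrite ler_wpM2l.
    by rewrite ?expr0 ?expr1 ?mulr1; ring.
  have i1 := @absorb _ _ _ _ (ev f z) (ev h z) _ d P0 d0 h2 p20 ler01.
  have i2 := @absorb _ _ _ _ (ev (D i f) z) (ev h z) _ d P0 d0 h1 p20 p0.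
  apply: le_trans (lerD i1 i2) _; rewrite mul1r le_eqVlt; apply/orP; left; apply/eqP; ring.
have JDt : J (D t (sqw k.+4 f)) <= J (Add (D t (sqw k.+4 f)) (esum sp G)).
  by rewrite stintD stint_esum big_seq big1 ?addr0.
move: JDt; rewrite stint_time.
pose K : R := 64 * (N + 1) * (2 * k.+4%:R) ^+ 2.
have K0 : 0 < K by rewrite /K !mulr_gt0// ?exprn_gt0//; lra.
(* Of the 2 h^2 that Green's identity supplies, 3/2 are kept: 1/2 is spent below on the gradient
   term, and 1 remains for the conclusion. *)
pose F := Add (Mul (Cst (- (3 / 2))) (sqw k.+4 h))
  (Add (Mul (Cst (1 + 2 * (N + 1) * N * c2 ^+ 2)) (sqw k f))
  (Add (sqw k (source f)) (Mul (Cst (K/2)) (esum sp (fun i => sqw k.+2 (D i f)))))).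
have FK : J (Add (D t (sqw k.+4 f)) (esum sp G)) <= J F.
  apply: stint_le => z.
  have -> : ev (Add (D t (sqw k.+4 f)) (esum sp G)) z =
    2 * ev w z * (ev f z * ev (D t f) z) + \sum_(i <- sp) ev (G i) z.
    rewrite [ev _ z]/= ev_esum; congr (_ + _).
    rewrite -[ev (D t psi) z * _ + _]/(ev (D t (pw k.+4)) z) D_pw_time.
    by rewrite mul0r add0r -[ev psi z * _]/(ev w z); ring.
  have S : \sum_(i <- sp) ev (G i) z <=
    2 * ev w z * (ev f z * ev (lap h) z) - 2 * ev w z * (ev h z * ev h z)
    + ev psi z ^+ k * (N * (2 * d * (ev psi z ^+ 2 * ev h z) ^+ 2)
     + N * (c2 ^+ 2 / (4 * d) * ev f z ^+ 2)
     + c1 ^+ 2 / (4 * d) * \sum_(i <- sp) (ev psi z * ev (D i f) z) ^+ 2).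
    apply: (@le_trans _ _ (\sum_(i <- sp) (2 * ev w z * (ev f z * ev (D i (D i h)) z) - 2 * ev w z * (ev h z * ev (D i (D i f)) z)
   + ev psi z ^+ k * (2 * d * (ev psi z ^+ 2 * ev h z) ^+ 2
     + c2 ^+ 2 / (4 * d) * ev f z ^+ 2 + c1 ^+ 2 / (4 * d) * (ev psi z * ev (D i f) z) ^+ 2)))).
      by rewrite big_seq [X in _ <= X]big_seq; apply: ler_sum => i isp; exact: G_le.
    rewrite !big_split sumrN -!mulr_sumr !big_split /= -!mulr_sumr !sum_spE.
    rewrite /lap -!ev_esum -/(lap f) -/h.
    by rewrite le_eqVlt; apply/orP; left; apply/eqP; ring.
  have -> : ev F z = - (3 / 2) * ev (sqw k.+4 h) z +
      ((1 + 2 * (N + 1) * N * c2 ^+ 2) * ev (sqw k f) z + (ev (sqw k (source f)) z +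
      K / 2 * ev (esum sp (fun i => sqw k.+2 (D i f))) z)) by [].
  rewrite ev_esum.
  have p0 := psi_ge0 z; have p1 := psi_le1 z.
  apply: le_trans (lerD (lexx _) S) _.
  have -> : \sum_(i <- sp) ev (sqw k.+2 (D i f)) z =
    ev psi z ^+ k * \sum_(i <- sp) (ev psi z * ev (D i f) z) ^+ 2.
    rewrite mulr_sumr; apply: eq_bigr => i _; rewrite ev_sqw !exprS expr0; ring.
  have := @sumr_ge0 _ _ sp xpredT (fun i => (ev psi z * ev (D i f) z) ^+ 2)
    (fun i _ => sqr_ge0 _).
  move: (\sum_(i <- sp) _) => s s0.
  have -> : c1 ^+ 2 / (4 * d) = K / 2.
    by rewrite /c1 /K /d; field; rewrite gt_eqF//; lra.
  have -> : c2 ^+ 2 / (4 * d) = 2 * (N + 1) * c2 ^+ 2.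
    by rewrite /d; field; rewrite gt_eqF//; lra.
  have dN : N * (2 * d) <= 4^-1.
    rewrite /d -[leRHS]mul1r -ler_pdivrMr ?invr_gt0//.
    rewrite (_ : _ / _ = N / (N + 1)); last by field; rewrite gt_eqF//; lra.
    by rewrite ler_pdivrMr; lra.
  rewrite /w !ev_sqw !ev_pw -[ev (source f) z]/(ev (D t f) z + ev (lap h) z).
  have P0 : 0 <= ev psi z ^+ k by rewrite exprn_ge0.
  have q0 : 0 <= ev psi z ^+ 4 by rewrite exprn_ge0.
  have q1 : ev psi z ^+ 4 <= 1 by rewrite exprn_ile1.
  have -> : (ev psi z ^+ 2 * ev h z) ^+ 2 = ev psi z ^+ 4 * ev h z ^+ 2.
    by rewrite exprMn -exprM.
  have -> : ev psi z ^+ k.+4 = ev psi z ^+ k * ev psi z ^+ 4 by rewrite -exprD addn4.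
  move: (ev psi z ^+ k) (ev psi z ^+ 4) (ev h z) (ev (lap h) z) (ev (D t f) z) (ev f z) P0 q0 q1.
  move=> P q hz lh ft fz P0 q0 q1.
  rewrite -subr_ge0.
  (* The difference is a sum of nonnegative terms, where q = psi^4 lies in [0, 1]. *)
  rewrite [X in 0 <= X](_ : _ = P * ((2^-1 - N * (2 * d)) * (q * hz ^+ 2) +
    (1 - q) * (fz ^+ 2 + (ft + lh) ^+ 2) + q * (fz - (ft + lh)) ^+ 2)); last by field.
  apply: mulr_ge0 => //; apply: addr_ge0; first apply: addr_ge0; apply: mulr_ge0.
  - lra.
  - by rewrite mulr_ge0// sqr_ge0.
  - by rewrite subr_ge0.
  - by rewrite addr_ge0// sqr_ge0.
  - by [].
  - exact: sqr_ge0.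
move=> h1; have := le_trans h1 FK.
rewrite /F !stintD !stintZ stint_esum => h2.
(* For eps = 1 / (2 K) the gradient term, of coefficient K / 2, costs exactly half of the energy of
   h. *)
have K20 : 0 < (2 * K)^-1 by rewrite invr_gt0 mulr_gt0.
have h3 := energy_gradient k f K20.
have h4 : K / 2 * (\sum_(i <- sp) E k.+2 (D i f)) <=
   2^-1 * E k.+4 h + K / 2 * (4 * k.+2%:R ^+ 2 * N + K) * E k f.
  have K2 : 0 <= K / 2 by rewrite divr_ge0// ltW.
  apply: le_trans (ler_wpM2l K2 h3) _; rewrite le_eqVlt; apply/orP; left; apply/eqP.
  have -> : 2 * (2 * K)^-1 = K^-1 by rewrite invfM mulrA divff ?mul1r ?pnatr_eq0.
  rewrite invrK mulrDr !mulrA.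
  by rewrite (mulrAC K) divff ?mul1r// gt_eqF.
have EE : energy_cst k = 1 + 2 * (N + 1) * N * c2 ^+ 2 +
    K / 2 * (4 * k.+2%:R ^+ 2 * N + K) by [].
rewrite EE; lra.
Qed.


Lemma energy_ge0 k f : 0 <= E k f.
Proof.
have <- : J (Cst 0) = 0 by rewrite stint_cst mul0r.
apply: stint_le => z; rewrite ev_sqw /=.
by rewrite mulr_ge0 ?exprn_ge0 ?psi_ge0// -expr2 sqr_ge0.
Qed.

Lemma energy_bound k f c : (forall z, `|ev f z| <= c) -> E k f <= c ^+ 2 * box_volume.
Proof.
move=> fc; rewrite -(stint_cst _ z0); apply: stint_le => z; rewrite ev_sqw /=.
rewrite -[leRHS]mul1r ler_pM//.
- by rewrite exprn_ge0// psi_ge0.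
- by rewrite -expr2 sqr_ge0.
- by rewrite exprn_ile1 ?psi_ge0 ?psi_le1.
- rewrite -expr2 -real_normK ?num_real// ler_sqr// ?nnegrE//.
  exact: le_trans (fc z).
Qed.

Lemma spint_sqw_bound s k f c : (forall z, `|ev f (upd z t s)| <= c) ->
  spint s (sqw k f) z0 <= c ^+ 2 * \prod_(i <- sp) (hi i - lo i).
Proof.
move=> fc; rewrite -(spint_cst s _ z0); apply: spint_le => z; rewrite ev_sqw /=.
rewrite -[leRHS]mul1r ler_pM//.
- by rewrite exprn_ge0// psi_ge0.
- by rewrite -expr2 sqr_ge0.
- by rewrite exprn_ile1 ?psi_ge0 ?psi_le1.
- rewrite -expr2 -real_normK ?num_real// ler_sqr// ?nnegrE//.
  exact: le_trans (fc z).
Qed.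

Lemma spint_sqw_mono s k k' f : (k <= k')%N ->
  spint s (sqw k' f) z0 <= spint s (sqw k f) z0.
Proof.
move=> kk'; apply: spint_le => z; rewrite !ev_sqw ler_wpM2r//.
  by rewrite -expr2 sqr_ge0.
by rewrite ler_wiXn2l// ?psi_ge0 ?psi_le1.
Qed.

Lemma spintD s e f : spint s (Add e f) z0 = spint s e z0 + spint s f z0.
Proof.
have b h : boxcont (fun z => ev h (upd z t s)).
  by apply: boxcont_updr => //; exact: ev_boxcont.
by rewrite /spint (IntLD lohi sp (b e) (b f)).
Qed.

(** * Pointwise control by integrals of derivatives *)

Definition Dw (s : seq 'I_m) f := foldr D f s.

(* The sum of the squares of all derivatives of [f] that take each direction of
   [l] at most once: enough to control [f] pointwise, see [sobolev]. *)
Fixpoint sob (l : seq 'I_m) f :=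
  if l is j :: l' then Add (sob l' f) (sob l' (D j f)) else Mul f f.

Lemma sob_bound s k l f M :
  (forall w, {subset w <= l} -> (size w <= size l)%N ->
    spint s (sqw k (Dw w f)) z0 <= M) ->
  spint s (Mul (pw k) (sob l f)) z0 <= 2 ^+ size l * M.
Proof.
elim: l f => [|j l IH] f H.
  by rewrite expr0 mul1r; exact: (H [::]).
rewrite [sob _ _]/=.
have -> : spint s (Mul (pw k) (Add (sob l f) (sob l (D j f)))) z0 =
    spint s (Mul (pw k) (sob l f)) z0 + spint s (Mul (pw k) (sob l (D j f))) z0.
  rewrite -spintD /spint; congr (IntL _ _ _ _ _); apply/funext => z /=; ring.
rewrite (_ : 2 ^+ size (j :: l) * M = 2 ^+ size l * M + 2 ^+ size l * M); last first.
  by rewrite /= exprS; ring.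
rewrite lerD//; last first.
  apply: IH => w wl ws; have := H (rcons w j).
  rewrite /Dw foldr_rcons size_rcons; apply => //.
  move=> i; rewrite mem_rcons !inE => /orP[->//|/wl ->]; exact: orbT.
apply: IH => w wl ws; apply: H => //; last exact: leqW.
by move=> i /wl; rewrite inE orbC => ->.
Qed.

Lemma prim_le_Int d g z : boxcont g -> (forall z, 0 <= g z) ->
  prim lo hi d g z <= Int lo hi d g z.
Proof.
move=> bg g0; rewrite (prim_clip lohi)// /Int.
apply: (pd_mono lohi (prim_boxcont lohi d bg) (pd_prim lohi bg)) => //.
by have /andP[] := clip_itv (z 0 d) (ltW (lohi d)).
Qed.

(** As psi^(k+1) f^2 vanishes on the face [lo j], it is the integral of its own derivative. The
    weight contributes 2 (k + 1), and 2 f D_j f <= f^2 + (D_j f)^2 contributes 1. *)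
Lemma sobolev_step k j f z : j \in sp ->
  ev (sqw k.+1 f) z <= (2 * k.+1%:R + 1) *
    Int lo hi j (ev (Add (sqw k f) (sqw k (D j f)))) z.
Proof.
move=> jsp; pose e := sqw k.+1 f; pose b := Add (sqw k f) (sqw k (D j f)).
pose c : R := 2 * k.+1%:R + 1.
have -> : ev (sqw k.+1 f) z = prim lo hi j (ev (D j e)) z.
  rewrite (prim_ftc lohi z (ev_boxcont e) (ev_boxcont _) (@ev_pd j e)).
  by rewrite [ev e (upd _ _ _)]ev_sqw psi_face//; [rewrite exprS !mul0r subr0|left].
have -> : c * Int lo hi j (ev b) z = Int lo hi j (ev (Mul (Cst c) b)) z.
  by have /= -> := IntLZ lohi [:: j] c (ev_boxcont b).
have b0 y : 0 <= ev b y.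
  have -> : ev b y = ev (sqw k f) y + ev (sqw k (D j f)) y by [].
  by rewrite !ev_sqw addr_ge0// mulr_ge0 ?exprn_ge0 ?psi_ge0// -expr2 sqr_ge0.
have c0 : 0 <= c by rewrite /c addr_ge0// mulr_ge0.
apply: le_trans (@prim_le_Int j (ev (Mul (Cst c) b)) z (ev_boxcont _) _); last first.
  by move=> y; exact: (mulr_ge0 c0 (b0 y)).
apply: (prim_le lohi) => [||y]; [exact: ev_boxcont|exact: ev_boxcont|].
have -> : ev (D j e) y = ev (D j (pw k.+1)) y * (ev f y * ev f y) +
  ev (pw k.+1) y * (ev (D j f) y * ev f y + ev f y * ev (D j f) y) by [].
have -> : ev (Mul (Cst c) b) y = c * (ev (sqw k f) y + ev (sqw k (D j f)) y) by [].
rewrite !ev_sqw ev_pw.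
have := D_pw_le k y jsp => /ler_normlP[_].
have p0 := psi_ge0 y; have p1 := psi_le1 y.
have P0 : 0 <= ev psi y ^+ k by rewrite exprn_ge0.
rewrite /c exprS; move: (ev psi y) (ev psi y ^+ k) p0 p1 P0 => p P p0 p1 P0.
move: (ev f y) (ev (D j f) y) (ev (D j (pw _)) y) => x x' w hw.
have h1 : w * (x * x) <= 2 * k.+1%:R * P * (x * x).
  by rewrite ler_wpM2r// -expr2 sqr_ge0.
have h2 : p * P * (x' * x + x * x') <= P * (x * x + x' * x').
  rewrite mulrAC mulrC ler_wpM2l//.
  have : 0 <= (x - x') ^+ 2 by exact: sqr_ge0.
  have : 0 <= (x + x') ^+ 2 by exact: sqr_ge0.
  nra.
have h3 : 0 <= 2 * k.+1%:R * P * (x' * x').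
  by apply: mulr_ge0; [rewrite !mulr_ge0|rewrite -expr2 sqr_ge0].
lra.
Qed.

Fixpoint sobolev_cst k n : R :=
  if n is n'.+1 then (2 * (k + n').+1%:R + 1) * sobolev_cst k n' else 1.

Lemma sobolev_cst_ge0 k n : 0 <= sobolev_cst k n.
Proof. by elim: n => //= n IH; rewrite mulr_ge0// addr_ge0// mulr_ge0. Qed.

(** Each direction costs one power of psi and one derivative in that direction, so only mixed
    derivatives without repetition occur. *)
Lemma sobolev k l f z : {subset l <= sp} ->
  ev (sqw (k + size l) f) z <=
  sobolev_cst k (size l) * IntL lo hi l (ev (Mul (pw k) (sob l f))) z.
Proof.
elim: l f z => [|j l IH] f z sl; first by rewrite addn0 mul1r.
have jsp : j \in sp by apply: sl; rewrite inE eqxx.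
have sl' : {subset l <= sp} by move=> i il; apply: sl; rewrite inE il orbT.
rewrite [size _]/= addnS; apply: le_trans (sobolev_step _ _ _ jsp) _.
rewrite [sobolev_cst _ _]/= -mulrA ler_wpM2l ?addr_ge0 ?mulr_ge0//.
have bC g : boxcont (IntL lo hi l (ev g)) by apply: IntL_boxcont => //; exact: ev_boxcont.
pose G := IntL lo hi l (ev (Mul (pw k) (sob (j :: l) f))).
have E : sobolev_cst k (size l) * Int lo hi j G z =
    Int lo hi j (fun y => sobolev_cst k (size l) * G y) z.
  have H := IntLZ lohi [:: j] (sobolev_cst k (size l)) (bC (Mul (pw k) (sob (j :: l) f))).
  exact: (esym (congr1 (fun F => F z) H)).
rewrite -[IntL lo hi (j :: l) _ z]/(Int lo hi j G z) E.
apply: (prim_le lohi) => [||y]; first exact: ev_boxcont.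
  by apply: boxcontZ; exact: bC.
rewrite /G [sob _ _]/=.
have -> : ev (Mul (pw k) (Add (sob l f) (sob l (D j f)))) =
   fun y => ev (Mul (pw k) (sob l f)) y + ev (Mul (pw k) (sob l (D j f))) y.
  by apply/funext => x /=; rewrite mulrDr.
rewrite (IntLD lohi l (ev_boxcont _) (ev_boxcont _)) mulrDr.
exact: lerD (IH f y sl') (IH (D j f) y sl').
Qed.

(** * Iteration of the energy estimate *)

Lemma source_D d f : ev (source (D d f)) = ev (D d (source f)).
Proof.
apply/funext => z; rewrite [LHS]/= [RHS]/=; congr (_ + _).
  by rewrite ev_DC.
by rewrite ev_D_lap (ev_lap_ext (ev_D_lap d f)).
Qed.

Lemma source_ext e f : ev e = ev f -> ev (source e) = ev (source f).
Proof.
move=> ef; apply/funext => z /=.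
by rewrite (ev_D_ext t ef) (ev_lap_ext (ev_lap_ext ef)).
Qed.

Lemma source_lap f : ev (source (lap f)) = ev (lap (source f)).
Proof.
rewrite (lap_Add (D t f) (lap (lap f))); apply/funext => z /=.
by rewrite ev_D_lap.
Qed.

Lemma source_Dw s f : ev (source f) = (fun=> 0) -> ev (source (Dw s f)) = fun=> 0.
Proof.
move=> sf; elim: s => [//|d s IH]; rewrite -[Dw _ _]/(D d (Dw s f)) source_D.
by rewrite (@ev_D_ext d _ (Cst 0)).
Qed.

(** The recursion of [energy_step]; the weight exponent rises by 2 with every derivative. *)
Fixpoint iter_cst (B M : R) k n : R :=
  if n is n'.+1 then
    let j := (k + n'.*2)%N in
    B + (energy_cst j + 4 * j.+2%:R ^+ 2 * N + 1) * iter_cst B M k n'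
  else M.

(** One evolution estimate bounds both the final time slice and the energy of [lap f];
    [energy_gradient] with eps = 1/2 trades the latter for first derivatives, which accounts for the
    summand 1. *)
Lemma energy_step k f B : ev (source f) = (fun=> 0) ->
  spint (lo t) (sqw k.+4 f) z0 <= B ->
  spint (hi t) (sqw k.+4 f) z0 <= B + energy_cst k * E k f /\
  forall i, i \in sp -> E k.+2 (D i f) <=
    B + (energy_cst k + 4 * k.+2%:R ^+ 2 * N + 1) * E k f.
Proof.
move=> sf hB; have := energy_evolution k f.
have -> : E k (source f) = 0.
  rewrite (@stint_ext _ (Cst 0)) ?stint_cst ?mul0r//.
  by apply/funext => z; rewrite ev_sqw sf mul0r mulr0.
have e4 := energy_ge0 k.+4 (lap f); have e0 := energy_ge0 k f.
rewrite addr0 => h; split; first lra.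
have s0 : 0 <= spint (hi t) (sqw k.+4 f) z0.
  have := @spint_le (hi t) (Cst 0) (sqw k.+4 f) z0.
  rewrite spint_cst mul0r; apply => z; rewrite ev_sqw mulr_ge0 ?exprn_ge0 ?psi_ge0//.
  by rewrite -expr2 sqr_ge0.
have i20 : 0 < 2^-1 :> R by rewrite invr_gt0.
have := energy_gradient k f i20; rewrite divff ?pnatr_eq0// invr1 mul1r => g i isp.
have : E k.+2 (D i f) <= \sum_(j <- sp) E k.+2 (D j f).
  rewrite (bigD1_seq i)//= lerDl; apply: sumr_ge0 => j _; exact: energy_ge0.
lra.
Qed.

Lemma iter_bound k f B M w : {subset w <= sp} -> ev (source f) = (fun=> 0) ->
  E k f <= M ->
  (forall s j, {subset s <= sp} -> (size s <= size w)%N ->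
     spint (lo t) (sqw j (Dw s f)) z0 <= B) ->
  E (k + (size w).*2) (Dw w f) <= iter_cst B M k (size w).
Proof.
move=> + sf EM; elim: w => [|i w IH] wsp HB; first by rewrite addn0.
have wsp' : {subset w <= sp} by move=> j jw; apply: wsp; rewrite inE jw orbT.
have isp : i \in sp by apply: wsp; rewrite inE eqxx.
have {}IH : E (k + (size w).*2) (Dw w f) <= iter_cst B M k (size w).
  by apply: IH => // s j ssp sw; apply: HB => //; exact: leqW.
have hB : spint (lo t) (sqw (k + (size w).*2).+4 (Dw w f)) z0 <= B.
  by apply: HB => //; exact: leqW.
have [_ /(_ i isp)] := energy_step (source_Dw w sf) hB.
rewrite [size _]/= doubleS !addnS => h; apply: le_trans h _.
rewrite /= lerD2l ler_wpM2l// addr_ge0// addr_ge0//.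
rewrite /energy_cst.
by rewrite !addr_ge0// ?mulr_ge0// ?addr_ge0// ?mulr_ge0 ?exprn_ge0// addr_ge0.
Qed.

Lemma Dw_lap s f : ev (Dw s (lap f)) = ev (lap (Dw s f)).
Proof. by elim: s => //= d s IH; rewrite (ev_D_ext d IH) ev_D_lap. Qed.

Lemma lap_initial0 f :
  (forall s (z : pt), {subset s <= sp} -> ev (Dw s f) (upd z t (lo t)) = 0) ->
  forall s z, {subset s <= sp} -> ev (Dw s (lap f)) (upd z t (lo t)) = 0.
Proof.
move=> H s z ssp; rewrite Dw_lap ev_esum big_seq big1// => i isp.
by apply: (H [:: i, i & s]) => j; rewrite !inE => /or3P[/eqP->|/eqP->|/ssp].
Qed.

(** [e1], [e2] and [M] bound the energies of Delta^2 P, Delta^3 P and Delta U with weights psi^4,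
    psi^8 and psi^8; [B] bounds initial energies. The exponent (8 + 2 n) + 4 is that of the final
    time slice after n derivatives. *)
Definition local_cst (n : nat) (c0 c1 : R) : R :=
  let vol := 2 ^+ n in
  let e1 := energy_cst 0 * (c0 ^+ 2 * vol) + c1 ^+ 2 * vol in
  let e2 := energy_cst 4 * e1 + (n%:R * c1) ^+ 2 * vol in
  let M := 2 * (c1 ^+ 2 * vol) + 2 * e2 in
  let B := c1 ^+ 2 * vol in
  sobolev_cst (8 + n.*2).+4 n * (2 ^+ n *
    \sum_(j < n.+1) (B + energy_cst (8 + j.*2) * iter_cst B M 8 j)).

Lemma energy_cst_ge0 k : 0 <= energy_cst k.
Proof.
rewrite /energy_cst.
by rewrite !addr_ge0// ?mulr_ge0// ?addr_ge0// ?mulr_ge0 ?exprn_ge0// addr_ge0.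
Qed.

Lemma iter_cst_ge0 B M k n : 0 <= B -> 0 <= M -> 0 <= iter_cst B M k n.
Proof.
move=> B0 M0; elim: n => //= n IH.
by rewrite addr_ge0// mulr_ge0// !addr_ge0// ?energy_cst_ge0// mulr_ge0//.
Qed.

End Energy.

Notation N := ((size sp)%:R : R).

(* [P] is the time primitive of [U]. As [source P] does not depend on time, the
   evolution estimate applies to [lap P], which is bounded, and to
   [lap (lap P)]; it bounds [lap U = source (lap P) - lap (lap (lap P))] in
   [L^2], and then all space derivatives of [lap U], one at a time. *)
Lemma local_bound (P U : expr) (c0 c1 : R) :
  ev (D t P) = ev U -> ev (source U) = (fun=> 0) ->
  (forall s (z : pt), {subset s <= sp} -> ev (Dw s P) (upd z t (lo t)) = 0) ->
  (forall z : pt, `|ev (lap P) z| <= c0) ->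
  (forall s (z : pt), {subset s <= sp} -> (size s <= (size sp).*2)%N ->
     `|ev (Dw s (lap U)) (upd z t (lo t))| <= c1) ->
  hi t - lo t <= 1 ->
  forall z : pt, z 0 t = hi t -> (forall i, i \in sp -> z 0 i = 0) ->
  ev (lap U) z ^+ 2 <= local_cst (size sp) c0 c1.
Proof.
move=> PU sU P0 Pc0 Uc1 ht z zt zsp.
have c10 : 0 <= c1.
  by apply: le_trans (Uc1 [::] z _ _).
have nilsp : {subset [::] <= sp} by [].
pose vol : R := 2 ^+ size sp.
have volE : \prod_(i <- sp) (hi i - lo i) = vol.
  rewrite /vol big_seq (eq_bigr (fun=> 2)).
    by rewrite -big_seq big_const_seq count_predT iter_mulr_1.
  by move=> i /space_itv[-> ->]; ring.
have vol0 : 0 <= vol by rewrite exprn_ge0.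
have bvol : box_volume <= vol.
  by rewrite /box_volume volE ler_piMl.
have lapP0 := lap_initial0 P0; have lap2P0 := lap_initial0 lapP0.
have srcP : ev (D t (source P)) = fun=> 0.
  by rewrite -source_D (source_ext PU).
have src1 : ev (D t (source (lap P))) = fun=> 0.
  rewrite (ev_D_ext t (source_lap P)) ev_D_lap (@ev_lap_ext _ (Cst 0))//.
  by apply/funext => y; rewrite ev_esum big1.
have src2 : ev (D t (source (lap (lap P)))) = fun=> 0.
  rewrite (ev_D_ext t (source_lap (lap P))) ev_D_lap (@ev_lap_ext _ (Cst 0))//.
  by apply/funext => y; rewrite ev_esum big1.
have DtlapP : ev (D t (lap P)) = ev (lap U).
  by rewrite ev_D_lap; exact: ev_lap_ext.
(* This source is constant in time, hence equal to its initial value, where all space derivatives of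
   P vanish and only [lap U] is left. *)
have b1 y : `|ev (source (lap P)) y| <= c1.
  rewrite -(upd_id y t) (ev_const y _ (lo t) src1).
  rewrite [ev _ _]/= DtlapP (lap_initial0 lap2P0 (s := [::]))// addr0.
  exact: (Uc1 [::]).
have b2 y : `|ev (source (lap (lap P))) y| <= N * c1.
  rewrite -(upd_id y t) (ev_const y _ (lo t) src2).
  rewrite [ev _ _]/= (lap_initial0 (lap_initial0 lap2P0) (s := [::]))// addr0.
  rewrite ev_D_lap (ev_lap_ext DtlapP) ev_esum -sum_spE.
  apply: le_trans (ler_norm_sum _ _ _) _.
  rewrite big_seq [X in _ <= X]big_seq; apply: ler_sum => i isp.
  apply: (Uc1 [:: i; i]); first by move=> j; rewrite !inE orbb => /eqP ->.
  by case: (sp) isp => [//|? ? _]; rewrite /= doubleS.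
pose e1 := energy_cst 0 * (c0 ^+ 2 * vol) + c1 ^+ 2 * vol.
pose e2 := energy_cst 4 * e1 + (N * c1) ^+ 2 * vol.
pose M := 2 * (c1 ^+ 2 * vol) + 2 * e2.
pose B := c1 ^+ 2 * vol.
have B0 : 0 <= B by rewrite mulr_ge0// sqr_ge0.
have Ele k f c : (forall y, `|ev f y| <= c) -> stint (sqw k f) z <= c ^+ 2 * vol.
  move=> fc; apply: le_trans (@energy_bound z k f c fc) _.
  by rewrite ler_wpM2l// sqr_ge0.
have ini0 k f : (forall y, ev f (upd y t (lo t)) = 0) -> spint (lo t) (sqw k f) z <= 0.
  move=> f0; apply: le_trans (@spint_sqw_bound z (lo t) k f 0 _) _.
    by move=> y; rewrite f0 normr0.
  by rewrite expr0n mul0r.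
have sp0 k f : 0 <= spint (hi t) (sqw k f) z.
  have := @spint_le (hi t) (Cst 0) (sqw k f) z.
  rewrite spint_cst mul0r; apply => y; rewrite ev_sqw mulr_ge0 ?exprn_ge0 ?psi_ge0//.
  by rewrite -expr2 sqr_ge0.
have E1 : stint (sqw 4 (lap (lap P))) z <= e1.
  have h0 := @energy_evolution z 0 (lap P).
  have h1 := ini0 4%N (lap P) (fun y => lapP0 [::] y nilsp).
  have h2 := sp0 4%N (lap P).
  have h3 := ler_wpM2l (energy_cst_ge0 0) (Ele 0%N _ _ Pc0).
  have h4 := Ele 0%N _ _ b1; rewrite /e1; lra.
have E2 : stint (sqw 8 (lap (lap (lap P)))) z <= e2.
  have h0 := @energy_evolution z 4 (lap (lap P)).
  have h1 := ini0 8%N (lap (lap P)) (fun y => lap2P0 [::] y nilsp).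
  have h2 := sp0 8%N (lap (lap P)).
  have h3 := ler_wpM2l (energy_cst_ge0 4) E1.
  have h4 := Ele 4%N _ _ b2; rewrite /e2; lra.
have EM : stint (sqw 8 (lap U)) z <= M.
  apply: le_trans (_ : stint (Add (Mul (Cst 2) (sqw 8 (source (lap P))))
     (Mul (Cst 2) (sqw 8 (lap (lap (lap P)))))) z <= _); last first.
    by rewrite stintD !stintZ lerD// ler_wpM2l//; exact: Ele.
  apply: stint_le => y.
  have -> : ev (Add (Mul (Cst 2) (sqw 8 (source (lap P))))
     (Mul (Cst 2) (sqw 8 (lap (lap (lap P)))))) y =
     2 * ev (sqw 8 (source (lap P))) y + 2 * ev (sqw 8 (lap (lap (lap P)))) y by [].
  rewrite !ev_sqw; have -> : ev (source (lap P)) y = ev (lap U) y + ev (lap (lap (lap P))) y.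
    by rewrite -DtlapP.
  move: (ev (lap U) y) (ev (lap (lap (lap P))) y) => a b.
  have q0 : 0 <= ev psi y ^+ 8 by rewrite exprn_ge0// psi_ge0.
  (* This is a^2 <= 2 (a + b)^2 + 2 b^2, with a + b the source and b = Delta^3 P. *)
  rewrite -subr_ge0 [X in 0 <= X](_ : _ = ev psi y ^+ 8 * (a + 2 * b) ^+ 2); last by ring.
  by rewrite mulr_ge0// sqr_ge0.
have sv : ev (source (lap U)) = fun=> 0.
  rewrite source_lap (@ev_lap_ext _ (Cst 0))//.
  by apply/funext => y; rewrite ev_esum big1.
have ini s j : {subset s <= sp} -> (size s <= size sp)%N ->
     spint (lo t) (sqw j (Dw s (lap U))) z <= B.
  move=> ssp ss; rewrite /B -volE; apply: spint_sqw_bound => y; apply: Uc1 => //.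
  by apply: leq_trans ss _; rewrite -addnn leq_addr.
have M0 : 0 <= M by apply: le_trans EM; exact: energy_ge0.
pose n := size sp.
(* [mm j] bounds the final energy of derivatives of order j; the sum over j serves all orders at
   once. *)
pose mm (j : nat) := B + energy_cst (8 + j.*2) * iter_cst B M 8 j.
have mm0 j : 0 <= mm j.
  by rewrite addr_ge0// mulr_ge0 ?energy_cst_ge0 ?iter_cst_ge0.
have W w : {subset w <= sp} -> (size w <= n)%N ->
    spint (hi t) (sqw (8 + n.*2).+4 (Dw w (lap U))) z <= \sum_(j < n.+1) mm j.
  move=> wsp wn.
  have Ew : stint (sqw (8 + (size w).*2) (Dw w (lap U))) z <= iter_cst B M 8 (size w).
    apply: iter_bound => // s j ssp sw; apply: ini => //; exact: leq_trans wn.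
  have [h _] := @energy_step z (8 + (size w).*2) (Dw w (lap U)) B (source_Dw w sv) (ini w _ wsp wn).
  apply: le_trans (_ : mm (size w) <= _); last first.
    have wn' : (size w < n.+1)%N by [].
    rewrite (bigD1 (Ordinal wn'))//= lerDl; exact: sumr_ge0.
  apply: le_trans (@spint_sqw_mono z (hi t) (8 + (size w).*2).+4 _ _ _) _.
    by rewrite -[X in (_ <= X)%N]addn4 -[X in (X <= _)%N]addn4 leq_add2r leq_add2l leq_double.
  apply: le_trans h _; by rewrite /mm lerD2l ler_wpM2l// energy_cst_ge0.
have := @sobolev (8 + n.*2).+4 sp (lap U) z (fun x => id).
(* Every factor 1 - x_i^2 equals 1 at the centre, so the weight drops out of the Sobolev bound. *)
have psi1 : ev psi z = 1.
  have : {subset sp <= sp} by [].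
  elim: {1 3}(sp) => [//|i l IH sl].
  rewrite -[ev _ _]/(ev (qx i) z * ev (bump l) z) IH; last first.
    by move=> j jl; apply: sl; rewrite inE jl orbT.
  have isp : i \in sp by apply: sl; rewrite inE eqxx.
  have [l1 h1] := space_itv isp.
  rewrite /= (zsp i isp) l1 h1 clip_id ?lerN10 ?ler01//; ring.
rewrite ev_sqw psi1 expr1n mul1r -expr2 => h; apply: le_trans h _.
rewrite /local_cst ler_wpM2l ?sobolev_cst_ge0//.
have := @sob_bound z (hi t) (8 + n.*2).+4 sp (lap U) _ W.
by rewrite /spint -IntL_upd// -zt upd_id.
Qed.
End Expr.

(** * The rescaled flow *)

Section Lines.
Context {R : realType}.

(** A chain rule along a line, for which directional derivability at the one point suffices. *)
Lemma is_derive_line (V : normedModType R) (g : V -> R) (a e : V) (r s : R) :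
  0 < r -> derivable g (a + (r * s) *: e) e ->
  is_derive s 1 (fun s => g (a + (r * s) *: e)) (r * 'D_e g (a + (r * s) *: e)).
Proof.
move=> r0 dg; apply: is_derive_eps => eps eps0.
set p := a + _; set l := 'D_e g p.
have er0 : 0 < eps / r by rewrite divr_gt0.
have := dg; rewrite /derivable => /cvgrPdist_le/(_ _ er0).
move=> /nbhs_ballP[k /= k0 Hk].
exists (k / r) => [|h hk]; first by rewrite divr_gt0.
have [->|h0] := eqVneq h 0.
  by rewrite addr0 subrr mul0r subr0 !normr0 mulr0.
have rh0 : r * h != 0 by rewrite mulf_neq0// gt_eqF.
have hb : `|0 - r * h| < k.
  by rewrite sub0r normrN normrM (gtr0_norm r0) mulrC -ltr_pdivlMr.
have {Hk} := Hk (r * h) hb rh0.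
have -> : a + (r * (s + h)) *: e = (r * h) *: e + p.
  by rewrite /p mulrDr scalerDl addrA addrC.
rewrite -/(derive g p e) -/l /GRing.scale/=.
set d := g _ - g p => H.
have -> : d - h * (r * l) = - (r * h) * (l - (r * h)^-1 * d).
  by field; rewrite h0 gt_eqF.
rewrite normrM normrN normrM (gtr0_norm r0) mulrC.
apply: le_trans (_ : eps / r * (r * `|h|) <= _).
  by rewrite ler_wpM2r// mulr_ge0// ltW.
by rewrite mulrA divfK ?gt_eqF.
Qed.

(** At an interior time small increments stay in [0, T], so the limit within [0, T] is an ordinary
    derivative. *)
Lemma is_derive_within (f : R -> R) (T c s l : R) : 0 < c -> 0 < c * s < T ->
  ((fun s' => (f s' - f (c * s)) / (s' - c * s)) @ within `[0, T] (c * s)^' --> l) ->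
  is_derive s 1 (fun s => f (c * s)) (c * l).
Proof.
move=> c0 /andP[cs0 csT] Hl; apply: is_derive_eps => eps eps0.
have er0 : 0 < eps / c by rewrite divr_gt0.
move: Hl => /cvgrPdist_le/(_ _ er0); rewrite near_withinE => /nbhs_ballP[k /= k0 Hk].
pose k' := Num.min k (Num.min (c * s) (T - c * s)).
have k'0 : 0 < k' by rewrite !lt_min k0 cs0 subr_gt0.
exists (k' / c) => [|h]; first by rewrite divr_gt0.
rewrite ltr_pdivlMr// mulrC => hk.
have [->|h0] := eqVneq h 0.
  by rewrite addr0 subrr mul0r subr0 !normr0 mulr0.
have ch0 : c * h != 0 by rewrite mulf_neq0// gt_eqF.
have : `|c * h| < k' by rewrite normrM gtr0_norm.
rewrite !lt_min => /and3P[h1 /ltr_normlP[h2 h3] /ltr_normlP[h4 h5]].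
have hb : `|c * s - c * (s + h)| < k by rewrite mulrDr opprD addNKr normrN.
have hn : c * (s + h) != c * s by rewrite mulrDr -subr_eq0 addrC addKr.
have := Hk (c * (s + h)) hb hn.
rewrite in_itv /= mulrDr; have -> : 0 <= c * s + c * h <= T by apply/andP; split; lra.
move=> /(_ isT); rewrite (addrC (c * s) (c * h)) addrK.
set d := f _ - f (c * s) => H.
have -> : d - h * (c * l) = - (c * h) * (l - d / (c * h)).
  by field; rewrite h0 gt_eqF.
rewrite normrM normrN normrM (gtr0_norm c0) mulrC.
apply: le_trans (_ : eps / c * (c * `|h|) <= _).
  by rewrite ler_wpM2r// mulr_ge0// ltW.
by rewrite mulrA divfK ?gt_eqF.
Qed.
End Lines.

(* Directions in ['I_n.+1]: [ord0] is time, [lift ord0 i] the [i]-th space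
   direction. *)
Section Scaled.
Context {R : realType} (n : nat) (T : R) (u : 'rV[R]_n -> R -> R).
Variables (x : 'rV[R]_n) (r S : R).
Hypotheses (r0 : 0 < r) (S0 : 0 < S) (rST : r ^+ 4 * S <= T).
Hypothesis su : smooth_slab T u.

Definition cyl_lo (d : 'I_n.+1) : R := if unlift ord0 d is Some _ then -1 else 0.
Definition cyl_hi (d : 'I_n.+1) : R := if unlift ord0 d is Some _ then 1 else S.
Definition space_dirs : seq 'I_n.+1 := map (lift ord0) (enum 'I_n).

Lemma cyl_lo_hi d : cyl_lo d < cyl_hi d.
Proof. by rewrite /cyl_lo /cyl_hi; case: unliftP => [i|] _ //; lra. Qed.

Lemma uniq_space_dirs : uniq space_dirs.
Proof. by rewrite map_inj_uniq ?enum_uniq//; exact: lift_inj. Qed.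

Lemma time_notin_space_dirs : ord0 \notin space_dirs.
Proof. by apply/mapP => -[i _] /eqP; rewrite (negbTE (neq_lift _ _)). Qed.

Lemma space_dirs_itv i : i \in space_dirs -> cyl_lo i = -1 /\ cyl_hi i = 1.
Proof. by move=> /mapP[j _ ->]; rewrite /cyl_lo /cyl_hi liftK. Qed.

Definition word (w : seq 'I_n.+1) := foldr (st_partial T) u (map (unlift ord0) w).
(* The chain rule factor of the scaling [y |-> x + r y], [s |-> r^4 s]. *)
Definition parabolic_weight (w : seq 'I_n.+1) :=
  foldr (fun d k => ((if unlift ord0 d is Some _ then 1 else 4) + k)%N) 0%N w.
Definition spatial (z : 'rV[R]_n.+1) : 'rV[R]_n := \row_j z 0 (lift ord0 j).
(** The derivative along w of u (x + r y, r^4 s), extended by projection; clamping also keeps the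
    time in [0, T], where u is smooth. *)
Definition scaled w (z : 'rV[R]_n.+1) : R :=
  r ^+ parabolic_weight w * word w (x + r *: spatial (clamp cyl_lo cyl_hi z))
    (r ^+ 4 * clamp cyl_lo cyl_hi z 0 ord0).

Lemma time_itv z : 0 <= r ^+ 4 * clamp cyl_lo cyl_hi z 0 ord0 <= T.
Proof.
have := clamp_itv cyl_lo_hi z ord0; rewrite /cyl_lo /cyl_hi unlift_none => /andP[h1 h2].
have r40 : 0 < r ^+ 4 by rewrite exprn_gt0.
apply/andP; split; first by rewrite mulr_ge0// ltW.
by apply: le_trans rST; rewrite ler_wpM2l// ltW.
Qed.

Lemma scaled_boxcont w : boxcont cyl_lo cyl_hi (scaled w).
Proof.
split; last by move=> z; rewrite /scaled clamp_clamp//; exact: cyl_lo_hi.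
pose g (z : 'rV[R]_n.+1) : 'rV[R]_n * R :=
  (x + r *: spatial (clamp cyl_lo cyl_hi z), r ^+ 4 * clamp cyl_lo cyl_hi z 0 ord0).
have cs : continuous (fun z => spatial (clamp cyl_lo cyl_hi z)).
  move=> z; apply/(@cvgrPdist_lt _ _ _ _ (nbhs_filter z)) => e e0.
  apply/nbhs_ballP; exists e => //= z' bz'.
  have h := close_clamp cyl_lo cyl_hi (proj1 (ball_close _ _ e0) bz').
  change (ball_ Num.norm (spatial (clamp cyl_lo cyl_hi z)) e (spatial (clamp cyl_lo cyl_hi z'))).
  rewrite -mx_norm_ball; split => // i j; have := h (lift ord0 j).
  by rewrite !mxE.
have c1 : continuous (fun z => x + r *: spatial (clamp cyl_lo cyl_hi z)).
  move=> z; apply: (@continuousD _ _ _ (cst x) (fun z => r *: spatial (clamp cyl_lo cyl_hi z))).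
    exact: cst_continuous.
  exact: (@continuousZl_tmp _ _ _ _ r z (cs z)).
have c2 : continuous (fun z => r ^+ 4 * clamp cyl_lo cyl_hi z 0 ord0).
  have := (@boxcontZ _ _ cyl_lo cyl_hi (r ^+ 4) _ (coord_boxcont cyl_lo_hi ord0)).1.
  by under eq_fun do rewrite -clampE.
have cg : continuous g.
  move=> z; exact: (cvg_pair (c1 z) (c2 z)).
have [cw _] := su (map (unlift ord0) w).
have := continuous_within_comp cw cg (fun z => time_itv z) => H z.
exact: (@continuousZl_tmp _ _ _ _ (r ^+ parabolic_weight w) z (H z)).
Qed.

Lemma scaled_pd d w : pd cyl_lo cyl_hi d (scaled w) (scaled (d :: w)).
Proof.
move=> z s; rewrite /cyl_lo /cyl_hi.
have [_ dw] := su (map (unlift ord0) w).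
have tz := time_itv z.
case: (unliftP ord0 d) => [i|] ed /andP[s1 s2].
  pose a := x + r *: spatial (upd (clamp cyl_lo cyl_hi z) d 0).
  pose t := r ^+ 4 * clamp cyl_lo cyl_hi z 0 ord0.
  have sp_upd s' : x + r *: spatial (upd (clamp cyl_lo cyl_hi z) d s') = a + (r * s') *: delta_mx 0 i.
    apply/rowP => j; rewrite !mxE eqxx /= -addrA; congr (_ + _).
    rewrite ed (inj_eq lift_inj); case: eqP => _; rewrite ?mulr0 ?mulr1 ?addr0 ?add0r//.
  have t_upd s' : clamp cyl_lo cyl_hi (upd z d s') 0 ord0 = clamp cyl_lo cyl_hi z 0 ord0.
    by rewrite clamp_upd updE ed (negbTE (neq_lift _ _)).
  have cl s' : -1 <= s' <= 1 -> clamp cyl_lo cyl_hi (upd z d s') = upd (clamp cyl_lo cyl_hi z) d s'.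
    by move=> h; rewrite clamp_upd clip_id// /cyl_lo /cyl_hi ed liftK.
  have der : is_derive s 1 (fun s => word w (a + (r * s) *: delta_mx 0 i) t)
      (r * partial i ((word w)^~ t) (a + (r * s) *: delta_mx 0 i)).
    by apply: is_derive_line => //; exact: (dw (Some i) _ _ tz).
  have -> : scaled (d :: w) (upd z d s) =
     r ^+ parabolic_weight w * (r * partial i ((word w)^~ t) (a + (r * s) *: delta_mx 0 i)).
    rewrite /scaled t_upd -/t cl ?(ltW s1) ?(ltW s2)// sp_upd /word /= ed liftK /=.
    by rewrite exprS; ring.
  apply: (@near_eq_is_derive _ _ _
    (fun s => r ^+ parabolic_weight w * word w (a + (r * s) *: delta_mx 0 i) t)).
  near=> s'; rewrite /scaled t_upd -/t cl ?sp_upd//.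
  by apply/andP; split; apply: ltW; near: s'; [exact: lt_nbhsr|exact: lt_nbhsl].
pose p := x + r *: spatial (clamp cyl_lo cyl_hi z).
have r40 : 0 < r ^+ 4 by rewrite exprn_gt0.
have p_upd s' : x + r *: spatial (clamp cyl_lo cyl_hi (upd z d s')) = p.
  congr (_ + _ *: _); apply/rowP => j; rewrite !mxE ed eq_sym.
  by rewrite (negbTE (neq_lift _ _)).
have t_upd s' : 0 <= s' <= S -> clamp cyl_lo cyl_hi (upd z d s') 0 ord0 = s'.
  move=> h; rewrite clamp_upd updE ed eqxx clip_id//.
  by rewrite /cyl_lo /cyl_hi unlift_none.
have sT : 0 < r ^+ 4 * s < T.
  rewrite mulr_gt0//=; apply: lt_le_trans rST; by rewrite ltr_pM2l.
have der : is_derive s 1 (fun s => word w p (r ^+ 4 * s))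
    (r ^+ 4 * time_deriv T (word w) p (r ^+ 4 * s)).
  apply: (is_derive_within r40 sT).
  have sT' : 0 <= r ^+ 4 * s <= T by case/andP: sT => ? ?; apply/andP; split; exact: ltW.
  exact: (dw None p _ sT').
have -> : scaled (d :: w) (upd z d s) =
   r ^+ parabolic_weight w * (r ^+ 4 * time_deriv T (word w) p (r ^+ 4 * s)).
  rewrite /scaled p_upd t_upd ?(ltW s1) ?(ltW s2)// /word /= ed unlift_none /=.
  by rewrite exprD; ring.
apply: (@near_eq_is_derive _ _ _ (fun s => r ^+ parabolic_weight w * word w p (r ^+ 4 * s))).
near=> s'; rewrite /scaled p_upd t_upd//.
by apply/andP; split; apply: ltW; near: s'; [exact: lt_nbhsr|exact: lt_nbhsl].
Unshelve. all: by end_near. Qed.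

(* [Du w] is the derivative of the rescaled flow along the word [w], and
   [Du_prim w] its primitive in time vanishing at time [0]. *)
Inductive atom := Du of seq 'I_n.+1 | Du_prim of seq 'I_n.+1.

Definition atom_val a := match a with
  | Du w => scaled w
  | Du_prim w => prim cyl_lo cyl_hi ord0 (scaled w)
  end.

(** A time derivative cancels the primitive and a space derivative passes under it, so the atoms are
    closed under differentiation. *)
Definition atom_deriv d a := match a with
  | Du w => Du (d :: w)
  | Du_prim w => if d == ord0 then Du w else Du_prim (d :: w)
  end.

Lemma atom_val_boxcont a : boxcont cyl_lo cyl_hi (atom_val a).
Proof.
case: a => w; first exact: scaled_boxcont.
by apply: (prim_boxcont cyl_lo_hi); exact: scaled_boxcont.
Qed.

Lemma atom_val_pd d a : pd cyl_lo cyl_hi d (atom_val a) (atom_val (atom_deriv d a)).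
Proof.
case: a => w; first exact: scaled_pd.
rewrite /=; case: eqVneq => [->|d0]; first exact: (pd_prim cyl_lo_hi (scaled_boxcont w)).
by apply: (pd_prim_other cyl_lo_hi d0); [exact: scaled_boxcont|exact: scaled_boxcont|exact: scaled_pd].
Qed.

(** * The equation and the bounds for the rescaled flow *)

Notation expr := (@expr R n.+1 atom).
Notation ev := (@ev R n.+1 cyl_lo cyl_hi atom atom_val).
Notation D := (@D R n.+1 atom atom_deriv).
Notation Dw := (@Dw R n.+1 atom atom_deriv).
Notation lap := (@lap R n.+1 atom atom_deriv space_dirs).
Definition expr_u : expr := Atom (Du [::]).
Definition expr_P : expr := Atom (Du_prim [::]).

Lemma sum_space_dirs (F : 'I_n.+1 -> R) : \sum_(i <- space_dirs) F i = \sum_(i < n) F (lift ord0 i).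
Proof. by rewrite big_map big_enum. Qed.

Lemma Dw_atom_u s w : Dw s (Atom (Du w)) = Atom (Du (s ++ w)).
Proof. by elim: s => //= d s ->. Qed.

Lemma Dw_atom_P s w : {subset s <= space_dirs} -> Dw s (Atom (Du_prim w)) = Atom (Du_prim (s ++ w)).
Proof.
elim: s => //= d s IH ssp; rewrite IH /=; last by move=> i si; apply: ssp; rewrite inE si orbT.
case: eqP => // d0; have := ssp d; rewrite d0 inE eqxx => /(_ isT).
by rewrite (negbTE time_notin_space_dirs).
Qed.

Lemma Dw_esum s l F : Dw s (esum l F) = esum l (fun i => Dw s (F i)).
Proof. by elim: s => //= d s ->; rewrite D_esum. Qed.

Lemma wordE J w t : (word (map (lift ord0) J ++ w))^~ t =
  foldr (@partial R n) ((word w)^~ t) J.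
Proof.
elim: J => //= i J IH; rewrite -IH.
by apply/funext => y; rewrite /word /= liftK.
Qed.

Lemma partial_sum (g : 'I_n -> 'rV[R]_n -> R) i :
  (forall j y, derivable (g j) y (delta_mx 0 i)) ->
  partial i (fun y => \sum_j g j y) = fun y => \sum_j partial i (g j) y.
Proof.
move=> dg; apply/funext => y; rewrite /partial.
have -> : (fun y => \sum_j g j y) = \sum_j g j by apply/funext => z; rewrite fct_sumE.
by rewrite derive_sum.
Qed.

Lemma laplacian2E t y : 0 <= t <= T -> laplacian (laplacian (u^~ t)) y =
  \sum_i \sum_j foldr (@partial R n) (u^~ t) [:: i; i; j; j] y.
Proof.
move=> tT; rewrite {1}/laplacian; apply: eq_bigr => i _.
have dw J k z : derivable (foldr (@partial R n) (u^~ t) J) z (delta_mx 0 k).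
  have := (su (map (unlift ord0) (map (lift ord0) J))).2 (Some k) z t tT.
  have := wordE J [::] t; rewrite cats0 => E.
  by rewrite /st_derivable -/(word (map (lift ord0) J)) E.
rewrite [laplacian _](_ : _ = fun y => \sum_j foldr (@partial R n) (u^~ t) [:: j; j] y)//.
rewrite partial_sum; last by move=> j z; exact: (dw [:: j; j]).
rewrite partial_sum//.
by move=> j z; exact: (dw [:: i; j; j]).
Qed.

Hypothesis flow : biharmonic_heat_flow T u.

Lemma D_expr_P : ev (D ord0 expr_P) = ev expr_u.
Proof. by []. Qed.

(** One time derivative and four space derivatives both carry the factor r^4, so the equation
    survives the scaling. *)
Lemma source_expr_u : ev (source atom_deriv ord0 space_dirs expr_u) = fun=> 0.
Proof.
apply/funext => z.
rewrite /source [ev _ z]/=.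
have -> : ev (lap (lap expr_u)) z = \sum_i \sum_j
    scaled [:: lift ord0 i; lift ord0 i; lift ord0 j; lift ord0 j] z.
  rewrite ev_esum sum_space_dirs; apply: eq_bigr => i _.
  by rewrite !D_esum ev_esum sum_space_dirs.
rewrite /scaled; set y := x + _; set t := r ^+ 4 * _.
have tT : 0 <= t <= T by exact: time_itv.
have -> : word [:: ord0] y t = - laplacian (laplacian (u^~ t)) y.
  by rewrite /word /= unlift_none /=; exact: flow.
rewrite laplacian2E// [parabolic_weight [:: ord0]]/= unlift_none /= mulrN mulr_sumr.
rewrite addrC; apply/eqP; rewrite subr_eq0; apply/eqP; apply: eq_bigr => i _.
rewrite mulr_sumr; apply: eq_bigr => j _.
rewrite !liftK /=; congr (_ * _).
by have := wordE [:: i; i; j; j] [::] t => /(congr1 (fun f => f y)).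
Qed.

Lemma ev_lap_expr_u z : ev (lap expr_u) z = r ^+ 2 *
  laplacian (u^~ (r ^+ 4 * clamp cyl_lo cyl_hi z 0 ord0)) (x + r *: spatial (clamp cyl_lo cyl_hi z)).
Proof.
rewrite ev_esum sum_space_dirs /laplacian mulr_sumr; apply: eq_bigr => i _.
rewrite /= /scaled /= !liftK /=; congr (_ * _).
by have := wordE [:: i; i] [::] (r ^+ 4 * clamp cyl_lo cyl_hi z 0 ord0) =>
  /(congr1 (fun f => f (x + r *: spatial (clamp cyl_lo cyl_hi z)))).
Qed.

Lemma expr_P_initial s z : {subset s <= space_dirs} -> ev (Dw s expr_P) (upd z ord0 (cyl_lo ord0)) = 0.
Proof.
by move=> ssp; rewrite Dw_atom_P//=; exact: (prim_lo cyl_lo_hi).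
Qed.

Variables (k0 k1 : R).
Hypothesis decay : forall t y, 0 <= t <= T -> t * `|laplacian (u^~ t) y| ^+ 2 <= k0.
Hypothesis (S1 : S <= 1) (r1 : r <= 1).
Hypothesis initial : forall (J : seq 'I_n) (y : 'rV[R]_n), (size J <= 2 * n + 2)%N ->
  (forall j, `|y 0 j| <= 1) -> `|foldr (@partial R n) (u^~ 0) J (x + r *: y)| <= k1.

(* The bound [|lap u| <= sqrt (k0 / s)] is integrable at [s = 0]: compare with
   [2 sqrt (k0 s)]. *)
Lemma lap_expr_P_bound z : `|ev (lap expr_P) z| <= 2 * Num.sqrt k0.
Proof.
set q := Num.sqrt k0.
have q0 : 0 <= q by exact: sqrtr_ge0.
have vq s : 0 < s < S -> `|ev (lap expr_u) (upd z ord0 s)| <= q / Num.sqrt s.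
  move=> /andP[s0 sS]; rewrite ler_pdivlMr ?sqrtr_gt0//.
  have hs : clamp cyl_lo cyl_hi (upd z ord0 s) 0 ord0 = s.
    rewrite clamp_upd upd_same clip_id// /cyl_lo /cyl_hi unlift_none.
    by apply/andP; split; exact: ltW.
  set v := ev _ _; rewrite mulrC -sqrtr_sqr -sqrtrM; last exact: ltW.
  apply: ler_wsqrtr; rewrite /v ev_lap_expr_u hs.
  (* Scale invariance of the hypothesis: s (r^2 L)^2 = (r^4 s) L^2. *)
  have := decay (x + r *: spatial (clamp cyl_lo cyl_hi (upd z ord0 s))) (time_itv (upd z ord0 s)).
  rewrite hs; set L := laplacian _ _; rewrite real_normK ?num_real//.
  by apply: le_trans; rewrite le_eqVlt; apply/orP; left; apply/eqP; ring.
pose W s := ev (lap expr_P) (upd z ord0 s).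
have W0 : W 0 = 0.
  have lo0 : cyl_lo ord0 = 0 by rewrite /cyl_lo unlift_none.
  have H := lap_initial0 cyl_lo_hi atom_val_boxcont atom_val_pd expr_P_initial.
  have nilsp : {subset [::] <= space_dirs} by [].
  by have := H [::] z nilsp; rewrite lo0.
have dW s : 0 < s < S -> is_derive s 1 W (ev (lap expr_u) (upd z ord0 s)).
  have := ev_pd atom_val_pd (d := ord0) (lap expr_P).
  rewrite (ev_D_lap cyl_lo_hi atom_val_boxcont atom_val_pd) (ev_lap_ext cyl_lo_hi atom_val_boxcont atom_val_pd _ D_expr_P) => H hs.
  by apply: H; rewrite /cyl_lo /cyl_hi unlift_none.
have cW : continuous W.
  move=> s; apply: line_continuous.
  exact: (boxcont_ucont cyl_lo_hi (ev_boxcont cyl_lo_hi atom_val_boxcont (lap expr_P))).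
have [c cS ->] : exists2 c, 0 <= c <= S & ev (lap expr_P) z = W c.
  exists (clip (cyl_lo ord0) (cyl_hi ord0) (z 0 ord0)).
    by have := clip_itv (z 0 ord0) (ltW (cyl_lo_hi ord0)); rewrite /cyl_lo /cyl_hi unlift_none.
  by rewrite -[in LHS](upd_id z ord0) (boxcont_upd cyl_lo_hi _ _ _ (ev_boxcont cyl_lo_hi atom_val_boxcont _)).
case/andP: cS => c0 cS.
have sc1 : Num.sqrt c <= 1 by rewrite -[leRHS]sqrtr1 ler_wsqrtr// (le_trans cS).
(* Both signs give the absolute value. The comparison function 2 q sqrt(s) - sg W(s) is continuous
   at 0, so its derivative matters for s > 0 only. *)
have key sg : sg = 1 \/ sg = -1 -> sg * W c <= 2 * q.
  move=> hsg.
  have sg1 : `|sg| = 1 by case: hsg => ->; rewrite ?normrN normr1.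
  have := @deriv_ge0_le R (fun s => 2 * q * Num.sqrt s - sg * W s)
    (fun s => 2 * q * (2 * Num.sqrt s)^-1 - sg * ev (lap expr_u) (upd z ord0 s)) 0 c c0.
  rewrite W0 sqrtr0 !mulr0 subr0 => H.
  have {H} : 0 <= 2 * q * Num.sqrt c - sg * W c.
    apply: H.
    - move=> s /andP[s0 sc]; apply: is_deriveB.
        have ds := is_derive1_sqrt s0; exact: (is_deriveZ (2 * q) ds).
      have ds : is_derive s 1 W (ev (lap expr_u) (upd z ord0 s)).
        by apply: dW; rewrite s0 (lt_le_trans sc).
      exact: (is_deriveZ sg ds).
    - apply: continuous_subspaceT => s.
      apply: (@continuousB R R R (fun s => 2 * q * Num.sqrt s) (fun s => sg * W s)).
        exact: (@continuousZl_tmp _ _ _ _ (2 * q) s (@sqrt_continuous R s)).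
      exact: (@continuousZl_tmp _ _ _ _ sg s (cW s)).
    - move=> s /andP[s0 sc].
      have hs : 0 < s < S by rewrite s0 (lt_le_trans sc).
      rewrite subr_ge0; apply: le_trans (ler_norm _) _; rewrite normrM sg1 mul1r.
      apply: le_trans (vq s hs) _; rewrite invfM mulrA (mulrAC 2 q) divff ?mul1r//.
  rewrite subr_ge0 => h; apply: le_trans h _.
  by rewrite ler_piMr// mulr_ge0.
rewrite ler_norml; apply/andP; split.
  by rewrite lerNl -mulN1r; apply: key; right.
by rewrite -[W c]mul1r; apply: key; left.
Qed.

Lemma space_dirs_lift s : {subset s <= space_dirs} -> exists J, s = map (lift ord0) J.
Proof.
elim: s => [|d s IH] ssp; first by exists [::].
have [|J ->] := IH; first by move=> i si; apply: ssp; rewrite inE si orbT.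
have /mapP[i _ ->] : d \in space_dirs by apply: ssp; rewrite inE eqxx.
by exists (i :: J).
Qed.

Lemma size_space_dirs : size space_dirs = n.
Proof. by rewrite size_map size_enum_ord. Qed.

(** Two derivatives of the Laplacian on top of 2 n others stay within the order 2 n + 2; the scaling
    factors are at most 1 since r <= 1, and n counts the terms of the Laplacian. *)
Lemma expr_u_initial s z : {subset s <= space_dirs} -> (size s <= (size space_dirs).*2)%N ->
  `|ev (Dw s (lap expr_u)) (upd z ord0 (cyl_lo ord0))| <= n%:R * k1.
Proof.
move=> /space_dirs_lift[J ->]; rewrite size_space_dirs size_map => Jn.
rewrite Dw_esum ev_esum sum_space_dirs.
have -> : n%:R * k1 = \sum_(i < n) k1 by rewrite sumr_const card_ord mulr_natl.
apply: le_trans (ler_norm_sum _ _ _) _; apply: ler_sum => i _.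
rewrite [Dw _ _](_ : _ = Atom (Du (map (lift ord0) (J ++ [:: i; i])))); last first.
  by rewrite map_cat -Dw_atom_u.
rewrite /= /scaled normrM ger0_norm ?exprn_ge0 ?(ltW r0)//.
set y := upd _ _ _.
have y0 : clamp cyl_lo cyl_hi y 0 ord0 = 0.
  by rewrite clamp_upd upd_same clip_id /cyl_lo /cyl_hi unlift_none ?lexx ?(ltW S0).
rewrite y0 mulr0.
have := wordE (J ++ [:: i; i]) [::] 0 => /(congr1 (fun f => f (x + r *: spatial (clamp cyl_lo cyl_hi y)))).
rewrite cats0 => ->.
have h := initial (J := J ++ [:: i; i]) (y := spatial (clamp cyl_lo cyl_hi y)).
rewrite -[leRHS]mul1r ler_pM ?exprn_ge0 ?(ltW r0)//.
  by rewrite exprn_ile1// ltW.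
apply: h; first by rewrite size_cat/= leq_add2r mul2n.
move=> j; rewrite mxE; have := clamp_itv cyl_lo_hi y (lift ord0 j).
by rewrite /cyl_lo /cyl_hi liftK ler_norml.
Qed.

Lemma scaled_laplacian_bound :
  (r ^+ 2 * laplacian (u^~ (r ^+ 4 * S)) x) ^+ 2 <=
  local_cst space_dirs n (2 * Num.sqrt k0) (n%:R * k1).
Proof.
(* The centre of the cube at the final time, which corresponds to the point (x, r^4 S). *)
pose z : 'rV[R]_n.+1 := \row_d if unlift ord0 d is Some _ then 0 else S.
have := local_bound cyl_lo_hi atom_val_boxcont atom_val_pd uniq_space_dirs time_notin_space_dirs space_dirs_itv D_expr_P source_expr_u
  expr_P_initial lap_expr_P_bound expr_u_initial.
rewrite {1}/cyl_lo {1}/cyl_hi unlift_none subr0 => /(_ S1 z).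
rewrite mxE /cyl_hi unlift_none => /(_ erefl) H.
have hz : clamp cyl_lo cyl_hi z 0 ord0 = S.
  by rewrite clampE mxE unlift_none clip_id // /cyl_lo /cyl_hi unlift_none lexx ltW.
have hy : spatial (clamp cyl_lo cyl_hi z) = 0.
  apply/rowP => j; rewrite !mxE liftK clip_id// /cyl_lo /cyl_hi liftK; apply/andP; split; lra.
have z0 i : i \in space_dirs -> z 0 i = 0 by move=> /mapP[j _ ->]; rewrite mxE liftK.
by have := H z0; rewrite ev_lap_expr_u hz hy scaler0 addr0 size_space_dirs.
Qed.

End Scaled.

(** * Cubes inside the unit ball and the choice of N *)

Section Final.
Context {R : realType} {n : nat}.

Lemma initial_derivatives (u0 : 'rV[R]_n -> R) (k1 : R) (J : seq 'I_n) (p : 'rV[R]_n) :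
  (ereal_sup [set (\sum_(0 <= i < (2 * n + 2).+1) sqnorm_nabla i u0 x)%:E
     | x in eball 0 1] <= k1%:E)%E ->
  (size J <= 2 * n + 2)%N -> eball 0 1 p ->
  `|foldr (@partial R n) u0 J p| <= Num.sqrt k1.
Proof.
move=> H Jn hp.
have {H} : \sum_(0 <= i < (2 * n + 2).+1) sqnorm_nabla i u0 p <= k1.
  by rewrite -lee_fin; apply: le_trans H; apply: ereal_sup_ubound; exists p.
rewrite big_mkord; have Jn' : (size J < (2 * n + 2).+1)%N by [].
have sq0 k : 0 <= sqnorm_nabla k u0 p by apply: sumr_ge0 => i _; exact: sqr_ge0.
rewrite (bigD1 (Ordinal Jn'))//= => h.
rewrite -sqrtr_sqr; apply: ler_wsqrtr; apply: le_trans h.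
apply: (@le_trans _ _ (sqnorm_nabla (size J) u0 p)).
  rewrite /sqnorm_nabla (bigD1 (in_tuple J))//= lerDl.
  by apply: sumr_ge0 => i _; exact: sqr_ge0.
by rewrite lerDl; apply: sumr_ge0 => i _; exact: sq0.
Qed.

Lemma enorm_ge0 (x : 'rV[R]_n) : 0 <= enorm x.
Proof. exact: sqrtr_ge0. Qed.

Lemma enorm_sqr (x : 'rV[R]_n) : enorm x ^+ 2 = \sum_(i < n) x 0 i ^+ 2.
Proof. by rewrite sqr_sqrtr//; apply: sumr_ge0 => i _; exact: sqr_ge0. Qed.

(** The half-diagonal sqrt(n) (1 - |x|) / (n + 1) is less than 1 - |x| because n < (n + 1)^2.
    Working with squares, convexity stands in for the triangle inequality. *)
Lemma box_in_ball (x y : 'rV[R]_n) : enorm x < 1 -> (forall j, `|y 0 j| <= 1) ->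
  eball 0 1 (x + ((1 - enorm x) / n.+1%:R) *: y).
Proof.
move=> x1 y1; set a := enorm x; set r := _ / _.
have a0 : 0 <= a by exact: enorm_ge0.
have r0 : 0 < 1 - a by rewrite subr_gt0.
have rr : r = (1 - a) / n.+1%:R by [].
have y2 j : y 0 j ^+ 2 <= 1.
  by rewrite -real_normK ?num_real// exprn_ile1.
(* convexity of the square: [x + r y = a (x / a) + (1 - a) (r y / (1 - a))] *)
have convex j : (x + r *: y) 0 j ^+ 2 * a <= x 0 j ^+ 2 + a * (r ^+ 2 / (1 - a)) .
  have -> : (x + r *: y) 0 j ^+ 2 * a =
     x 0 j ^+ 2 + a * (r ^+ 2 / (1 - a) * y 0 j ^+ 2)
      - ((1 - a) * x 0 j - a * r * y 0 j) ^+ 2 / (1 - a).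
    rewrite !mxE; have : 1 - a != 0 by rewrite gt_eqF.
    by move: (x 0 j) (y 0 j) (a) (r) => X Y b q hb; field.
  rewrite lerBlDr -[leLHS]addr0 lerD ?divr_ge0 ?sqr_ge0 ?(ltW r0)//.
  rewrite lerD2l ler_wpM2l// ler_piMr// divr_ge0 ?sqr_ge0// ltW//.
have rn : n%:R * (r ^+ 2 / (1 - a)) < 1 - a.
  rewrite [X in X < _](_ : _ = (1 - a) * (n%:R / n.+1%:R ^+ 2)); last first.
    rewrite rr.
    have : 1 - a != 0 by rewrite gt_eqF.
    have : n.+1%:R != 0 :> R by rewrite pnatr_eq0.
    by move: (n%:R) (n.+1%:R) (a) => k k' b h1 h2; field; rewrite h1.
  rewrite gtr_pMr// ltr_pdivrMr ?exprn_gt0// mul1r -natrX ltr_nat.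
  by rewrite expnS expn1 (leq_trans (ltnSn n))// leq_pmulr.
rewrite /eball /= subr0.
have : enorm (x + r *: y) ^+ 2 < 1.
  (* The convexity estimate carries a factor |x| and is void at x = 0, where the square is at most n
     r^2 directly. *)
  have [ea|ane] := eqVneq a 0.
    have x0 j : x 0 j = 0.
      have : \sum_(i < n) x 0 i ^+ 2 = 0 by rewrite -enorm_sqr -/a ea expr0n.
      move=> /eqP; rewrite psumr_eq0 => [/allP/(_ j)|i _]; last exact: sqr_ge0.
      by rewrite mem_index_enum sqrf_eq0 => /(_ isT)/eqP.
    rewrite enorm_sqr.
    apply: (@le_lt_trans _ _ (\sum_(i < n) r ^+ 2)).
      apply: ler_sum => i _; rewrite !mxE x0 add0r exprMn ler_piMr// sqr_ge0//.
    rewrite sumr_const card_ord -mulr_natl.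
    by move: rn; rewrite ea subr0 divr1.
  have a0' : 0 < a by rewrite lt_neqAle eq_sym ane.
  rewrite -(ltr_pM2r a0') mul1r enorm_sqr mulr_suml.
  apply: (@le_lt_trans _ _ (\sum_(i < n) (x 0 i ^+ 2 + a * (r ^+ 2 / (1 - a))))).
    by apply: ler_sum => i _; exact: convex.
  rewrite big_split /= -enorm_sqr -/a sumr_const card_ord -mulr_natl mulrCA.
  by rewrite expr2 -mulrDr gtr_pMr//; lra.
by rewrite expr_lt1// enorm_ge0.
Qed.
End Final.

(* In extended reals N%:E / 0 = +oo for N > 0, which is the convention at
   |x| = 1.  The bound k0 / t is stated in the form t |Delta u|^2 <= k0. *)
Theorem theorem1p1 (R : realType) (n : nat) (k0 k1 : R) :
  exists N : R, 0 < N /\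
    forall (T : R) (u : 'rV[R]_n -> R -> R),
      0 < T ->
      smooth_slab T u ->
      biharmonic_heat_flow T u ->
      (forall (t : R) (x : 'rV[R]_n), 0 <= t <= T ->
         t * `|laplacian (u^~ t) x| ^+ 2 <= k0) ->
      (ereal_sup [set (\sum_(0 <= i < (2 * n + 2).+1)
                         sqnorm_nabla i (u^~ 0) x)%:E
                 | x in eball 0 1] <= k1%:E)%E ->
      forall (x : 'rV[R]_n) (t : R),
        enorm x <= 1 ->
        N * t <= (1 - enorm x) ^+ 4 ->
        t <= N^-1 ->
        0 <= t <= T ->
        ((`|laplacian (u^~ t) x| ^+ 2)%:E <=
           N%:E / ((1 - enorm x) ^+ 4)%:E)%E.
Proof.
pose c1 : R := n%:R * Num.sqrt k1.
(* The absolute value avoids a discussion of sign, [c1 ^+ 2] covers the time 0, and the summand 1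
   gives C >= 1. *)
pose C := `|local_cst (space_dirs n) n (2 * Num.sqrt k0) c1| + c1 ^+ 2 + 1.
have C0 : 0 < C by rewrite /C ltr_wpDl// addr_ge0// sqr_ge0.
have CC : `|local_cst (space_dirs n) n (2 * Num.sqrt k0) c1| <= C.
  by rewrite /C -addrA lerDl addr_ge0// sqr_ge0.
have Cc : c1 ^+ 2 <= C by rewrite /C -addrA addrCA lerDl addr_ge0.
have C1 : 1 <= C by rewrite /C lerDr addr_ge0// sqr_ge0.
have n0 : 0 < n.+1%:R :> R by rewrite ltr0n.
have n4 : 1 <= n.+1%:R ^+ 4 :> R by rewrite exprn_ege1// ler1n.
exists (n.+1%:R ^+ 4 * C); split; first by rewrite mulr_gt0// exprn_gt0.
set N := _ * C.
have N0 : 0 < N by rewrite mulr_gt0// exprn_gt0.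
have CN : C <= N by rewrite /N ler_peMl// ltW.
move=> T u T0 su flow decay ini x t x1 Nt _ /andP[t0 tT].
have [e1|xlt] := eqVneq (enorm x) 1.
  by rewrite e1 subrr expr0n inve0 mulry gtr0_sg// mul1e leey.
have {xlt} xlt : enorm x < 1 by rewrite lt_neqAle xlt.
set rho := 1 - enorm x in Nt *.
have rho0 : 0 < rho by rewrite subr_gt0.
have rho1 : rho <= 1 by rewrite /rho gerBl enorm_ge0.
have rho40 : 0 < rho ^+ 4 by rewrite exprn_gt0.
rewrite inver gt_eqF// -EFinM lee_fin ler_pdivlMr// real_normK ?num_real//.
pose r := rho / n.+1%:R.
have r0 : 0 < r by rewrite divr_gt0.
have r1 : r <= 1 by rewrite ler_pdivrMr// mul1r (le_trans rho1)// ler1n.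
have inix (J : seq 'I_n) (y : 'rV[R]_n) : (size J <= 2 * n + 2)%N ->
    (forall j, `|y 0 j| <= 1) ->
    `|foldr (@partial R n) (u^~ 0) J (x + r *: y)| <= Num.sqrt k1.
  by move=> Jn y1; apply: initial_derivatives => //; exact: box_in_ball.
(* At t = 0 the cylinder degenerates; there the Laplacian is a sum of n second derivatives of the
   initial data. *)
have [et|tne] := eqVneq t 0.
  rewrite et; apply: (@le_trans _ _ (c1 ^+ 2)); last exact: le_trans CN.
  apply: (@le_trans _ _ (laplacian (u^~ 0) x ^+ 2)).
    by rewrite ler_piMr ?sqr_ge0// exprn_ile1// ltW.
  rewrite -real_normK ?num_real// ler_sqr ?nnegrE ?mulr_ge0 ?sqrtr_ge0//.
  rewrite /c1 mulr_natl -[in leRHS](card_ord n) -sumr_const.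
  apply: le_trans (ler_norm_sum _ _ _) _; apply: ler_sum => i _.
  have := inix [:: i; i] 0; rewrite scaler0 addr0; apply.
    by rewrite leq_addl.
  by move=> j; rewrite mxE normr0.
have {tne} t0' : 0 < t by rewrite lt_neqAle eq_sym tne.
have r40 : 0 < r ^+ 4 by rewrite exprn_gt0.
pose S := t / r ^+ 4.
have S0 : 0 < S by rewrite divr_gt0.
have rS : r ^+ 4 * S = t by rewrite mulrC divfK// gt_eqF.
(* From N t <= rho^4 and N >= (n + 1)^4, that is t <= r^4. *)
have S1 : S <= 1.
  rewrite ler_pdivrMr// mul1r /r expr_div_n ler_pdivlMr ?exprn_gt0// mulrC.
  by apply: le_trans Nt; rewrite ler_wpM2r// /N ler_peMr// ltW// exprn_gt0.
have rST : r ^+ 4 * S <= T by rewrite rS.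
have := scaled_laplacian_bound r0 S0 rST su flow decay S1 r1 inix.
rewrite rS => h.
have hC := le_trans (le_trans h (ler_norm _)) CC.
rewrite (_ : _ * _ = n.+1%:R ^+ 4 * (r ^+ 2 * laplacian (u^~ t) x) ^+ 2).
  by apply: ler_wpM2l; [exact: le_trans ler01 n4|exact: hC].
have k0' : n.+1%:R ^+ 4 != 0 :> R by rewrite expf_neq0// gt_eqF.
have -> : (r ^+ 2 * laplacian (u^~ t) x) ^+ 2 =
    rho ^+ 4 / n.+1%:R ^+ 4 * laplacian (u^~ t) x ^+ 2.
  by rewrite exprMn -exprM expr_div_n.
by rewrite mulrA (mulrC (_ ^+ 4)) divfK// mulrC.
Qed.
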